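(* Let $N$ be a feed-forward network with layers $C_0,\dots,C_m$, $f\in\mathcal{V}_0(N)$ generic and $L$ a feed-forward lift of $N$ such that $L$ is backward connected and is a lift inside a layer $C_j$, where $0<j<m-1$. If $f_i>0$ for every $1\le i\le k$ (or $f_i<0$ for every $1\le i\le k$), then there is a bifurcation branch of $f$ on $L$ which is not lifted from $N$.
   Context: A network $N$ with $k$ edge types is a finite set of cells $C$ together with functions $\sigma_1,\dots,\sigma_k:C\to C$ ($\sigma_i(c)$ is the source of the unique edge of type $i$ targeting $c$); $|N|=|C|$. Networks represented by $(\sigma_i:C\to C)$ and $(\sigma_i':C'\to C')$ are equal if there is a bijection $\varphi:C\to C'$ with $\varphi\circ\sigma_i=\sigma_i'\circ\varphi$ for all $i$. A feed-forward network is a network whose cells can be partitioned into nonempty layers $C_0,\dots,C_m$ such that $\sigma_i(c)=c$ for $c\in C_0$ and all $i$; $\sigma_i(C_j)\subseteq C_{j-1}$ for $1\le j\le m$ and all $i$; and for $0\le j\le m-1$ every $c\in C_j$ equals $\sigma_i(c')$ for some $c'\in C_{j+1}$ and some $i$. Feed-forward networks are assumed connected (as undirected graphs). A network is backward connected if there is a cell $c$ such that every other cell $c'$ can be joined to $c$ by a directed path from $c'$ to $c$. A coloring is an equivalence relation $\bowtie$ on the cells; it is balanced if $c\bowtie c'$ implies $\sigma_i(c)\bowtie\sigma_i(c')$ for all $i$. The quotient network $N/\bowtie$ has the $\bowtie$-classes as cells and is represented by $\sigma_i^{\bowtie}([c]_{\bowtie})=[\sigma_i(c)]_{\bowtie}$.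 $L$ is a lift of $N$ if $N=L/\bowtie$ for some balanced coloring $\bowtie$ in $L$. For a feed-forward lift $L$ (layers $C'_0,\dots,C'_n$) of a feed-forward network $N$ (layers $C_0,\dots,C_m$), $L$ is a lift inside the layer $C_j$ if $m=n$, $|C'_j|\ne|C_j|$ and $|C'_i|=|C_i|$ for $i\ne j$. $\mathcal{V}(N)$ is the set of smooth $f:\mathbb{R}\times\mathbb{R}^k\times\mathbb{R}\to\mathbb{R}$, $(x_0,x_1,\dots,x_k,\lambda)\mapsto f$, with $f(0,\dots,0,\lambda)=0$ for all $\lambda$; $f_i=\partial f/\partial x_i$ at the origin. $\mathcal{V}_0(N)=\{f\in\mathcal{V}(N): f_0=0\}$. It depends only on $k$, so $\mathcal{V}_0(N)=\mathcal{V}_0(L)$. The vector field is $(f^N(x,\lambda))_c=f(x_c,x_{\sigma_1(c)},\dots,x_{\sigma_k(c)},\lambda)$ on $\mathbb{R}^{|N|}$. ''Generic'' means: there is an open dense subset $O$ of the space of possible values of the first and second order partial derivatives at the origin of elements of the class, such that the statement holds for every $f$ in the class whose derivatives lie in $O$. A domain is an interval $]-\lambda_0,0]$, $]-\lambda_0,\lambda_0[$ or $[0,\lambda_0[$ with $\lambda_0>0$. An equilibrium branch of $f$ on $N$ is a function $b:D\to\mathbb{R}^{|N|}$ on a domain $D$ with $b(0)=0$ and $f^N(b(\lambda),\lambda)=0$ for all $\lambda\in D$, which is smooth if $D=]-\lambda_0,\lambda_0[$, and continuous on $D$ and smooth on $D\setminus\{0\}$ if $D$ is one-sided. Branches are taken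 as germs: $b_1:D_1\to\mathbb{R}^{|N|}$ and $b_2:D_2\to\mathbb{R}^{|N|}$ are related if there is an open neighborhood $U$ of $0$ with $U\cap D_1\cap D_2\ne\{0\}$ and $b_1=b_2$ on $U\cap D_1\cap D_2$; germ equivalence is the transitive closure, and equivalent branches are identified. The bifurcation branches are the equilibrium branches different from the trivial branch $0$. A bifurcation branch $b$ of $f$ on $L$ is lifted from $N$ if there is a balanced coloring $\bowtie$ in $L$ with $N=L/\bowtie$ and $b\in\Delta_{\bowtie}$, i.e. $b(\lambda)\in\Delta_{\bowtie}=\{x: c\bowtie d\Rightarrow x_c=x_d\}$ for all $\lambda$ in the domain near $0$. *)

(* Defs.v *)
From HB Require Import structures.
From Stdlib Require Export Relation_Operators.
From mathcomp Require Export all_boot all_order all_algebra.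
From mathcomp Require Export all_classical all_reals all_analysis.

Set Implicit Arguments.
Unset Strict Implicit.
Unset Printing Implicit Defensive.

Import Order.TTheory GRing.Theory Num.Theory.
Import numFieldNormedType.Exports.

Local Open Scope classical_set_scope.
Local Open Scope quotient_scope.
Local Open Scope ring_scope.

(* [src i c] is the source of the unique edge of type [i] targeting [c]. *)
Record network (k : nat) := Network {
  cell : finType;
  src : 'I_k -> cell -> cell }.

Arguments cell {k} n.
Arguments src {k n} i c.

Definition net_eq k (N N' : network k) : Prop :=
  exists phi : cell N -> cell N',
    bijective phi /\ forall i c, phi (src i c) = src i (phi c).

Definition edge k (N : network k) : rel (cell N) :=
  fun c d => [exists i, src i d == c].

Definition connected_net k (N : network k) : Prop :=
  forall c d, connect (fun x y => @edge k N x y || @edge k N y x) c d.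

Definition backward_connected k (N : network k) : Prop :=
  exists c : cell N, forall c', c' != c -> connect (@edge k N) c' c.

(* The layers are C 0, ..., C m; the values of C beyond m are irrelevant. *)
Definition feed_forward k (N : network k) (m : nat)
    (C : nat -> {set cell N}) : Prop :=
  [/\ (forall j, (j <= m)%N -> C j != finset.set0) /\
        (forall c, exists! j, (j <= m)%N /\ c \in C j),
      forall i c, c \in C 0%N -> src i c = c,
      forall j i c, (1 <= j <= m)%N -> c \in C j -> src i c \in C j.-1,
      forall j c, (j < m)%N -> c \in C j ->
        exists2 c', c' \in C j.+1 & exists i, c = src i c'
    & connected_net N].

Definition balanced k (N : network k) (e : equiv_rel (cell N)) : Prop :=
  forall c c', e c c' -> forall i, e (src i c) (src i c').

Definition quotient_finType (T : finType) (e : equiv_rel T) : finType :=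
  HB.pack_for finType {eq_quot e} (CanIsFinite (@reprK T {eq_quot e})).

(* [src i [c] = [src i c]] holds as soon as [e] is balanced; [quotient_net] is
   only used for balanced colorings. *)
Definition quotient_net k (N : network k) (e : equiv_rel (cell N)) :
    network k :=
  @Network k (quotient_finType e)
    (fun i (q : {eq_quot e}) => \pi_{eq_quot e} (src i (repr q))).

Definition is_lift k (L N : network k) : Prop :=
  exists e : equiv_rel (cell L), balanced e /\ net_eq N (quotient_net e).

Definition lift_inside_layer k (N L : network k) (m n : nat)
    (C : nat -> {set cell N}) (C' : nat -> {set cell L}) (j : nat) : Prop :=
  [/\ m = n, #|C' j| <> #|C j|
    & forall i, (i <= m)%N -> i <> j -> #|C' i| = #|C i|].

(* The arguments (x_0, (x_1, ..., x_k), lambda) of a response function are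
   collected in one row vector. *)
Definition inputs (R : realType) (k : nat) := 'rV[R]_(1 + (k + 1)).

Definition mk_inputs (R : realType) k (x0 : R) (x : 'rV[R]_k) (l : R) :
    inputs R k :=
  row_mx x0%:M (row_mx x l%:M).

Definition idx0 k : 'I_(1 + (k + 1)) := lshift (k + 1) ord0.
Definition idx k (i : 'I_k) : 'I_(1 + (k + 1)) := rshift 1 (lshift 1 i).

Definition partial (R : realType) n (i : 'I_n) (f : 'rV[R]_n -> R) :
    'rV[R]_n -> R :=
  'D_(delta_mx ord0 i) f.

(* C^oo: f and all its iterated partial derivatives are (Frechet)
   differentiable everywhere. *)
Definition smooth (R : realType) n (f : 'rV[R]_n -> R) : Prop :=
  forall (s : seq 'I_n) x, differentiable (foldr (@partial R n) f s) x.

(* Meaningful for open A, where the derivatives at the points of A only depend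
   on the restriction of g to A. *)
Definition smooth_on (R : realType) (A : set R) (g : R -> R) : Prop :=
  forall n x, A x -> derivable (derive1n n g) x 1.

(* V(N) and V_0(N); they depend on N only through its number k of edge types. *)
Definition classV (R : realType) k : set (inputs R k -> R) :=
  [set f | smooth f /\ forall l, f (mk_inputs 0 0 l) = 0].

Definition classV0 (R : realType) k : set (inputs R k -> R) :=
  [set f | classV f /\ partial (idx0 k) f 0 = 0].

Definition jet2 (R : realType) n (f : 'rV[R]_n -> R) : 'rV[R]_n * 'M[R]_n :=
  (\row_i partial i f 0, \matrix_(i, j) partial i (partial j f) 0).

(* The open dense set O is open and dense relative to the space [jet2 @` F] of
   the jets of elements of the class F. *)
Definition generically (R : realType) n (F : set ('rV[R]_n -> R))
    (P : ('rV[R]_n -> R) -> Prop) : Prop :=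
  exists O : set ('rV[R]_n * 'M[R]_n),
    [/\ exists2 U : set ('rV[R]_n * 'M[R]_n), open U & O = U `&` (@jet2 R n) @` F,
        (@jet2 R n) @` F `<=` closure O
      & forall f, F f -> O (jet2 f) -> P f].

Definition vfield (R : realType) k (f : inputs R k -> R) (N : network k)
    (x : cell N -> R) (l : R) : cell N -> R :=
  fun c => f (mk_inputs (x c) (\row_i x (src i c)) l).

Variant domain_kind := left_sided | two_sided | right_sided.

Definition domain (R : realType) (s : domain_kind) (l0 : R) : set R :=
  match s with
  | left_sided => `]- l0, 0]
  | two_sided => `]- l0, l0[
  | right_sided => `[0, l0[
  end.

Definition branch_regular (R : realType) (s : domain_kind) (l0 : R)
    (g : R -> R) : Prop :=
  match s with
  | two_sided => smooth_on (domain s l0) g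
  | _ => {within domain s l0, continuous g} /\
         smooth_on (domain s l0 `\ 0) g
  end.

(* Only the values of [bfun] on the domain matter. *)
Record branch (R : realType) k (f : inputs R k -> R) (N : network k) := Branch {
  bkind : domain_kind;
  bradius : R;
  bfun :> R -> cell N -> R;
  bradius_gt0 : 0 < bradius;
  bfun0 : forall c, bfun 0 c = 0;
  bfun_eq : forall l, domain bkind bradius l ->
    forall c, vfield f (bfun l) l c = 0;
  bfun_regular : forall c, branch_regular bkind bradius (bfun^~ c) }.

Section Germs.
Variables (R : realType) (k : nat) (f : inputs R k -> R).

Definition bdom (N : network k) (b : branch f N) : set R :=
  domain (bkind b) (bradius b).

Definition germ_related (N : network k) (b1 b2 : branch f N) : Prop :=
  exists U : set R,
    [/\ open U, U 0, U `&` bdom b1 `&` bdom b2 <> [set 0]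
      & forall l, (U `&` bdom b1 `&` bdom b2) l -> forall c, b1 l c = b2 l c].

Definition germ_equiv (N : network k) : branch f N -> branch f N -> Prop :=
  clos_trans (branch f N) (@germ_related N).

(* The germ of b differs from the germ of the trivial branch. *)
Definition bifurcation_branch (N : network k) (b : branch f N) : Prop :=
  ~ exists2 b0 : branch f N,
      (forall l, bdom b0 l -> forall c, b0 l c = 0) & germ_equiv b b0.

Definition in_synchrony_space (L : network k) (e : equiv_rel (cell L))
    (b : branch f L) : Prop :=
  \forall l \near 0, bdom b l -> forall c d, e c d -> b l c = b l d.

(* Since equivalent branches are identified, this is a property of the germ of
   b: some representative lies in the synchrony space near 0. *)
Definition lifted_from (N L : network k) (b : branch f L) : Prop :=
  exists e : equiv_rel (cell L),
    [/\ balanced e, net_eq N (quotient_net e)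
      & exists2 b' : branch f L, germ_equiv b b' & in_synchrony_space e b'].

End Germs.

(* Main.v *)
Require Import Defs.
From mathcomp Require Import ring lra.

Set Implicit Arguments.
Unset Strict Implicit.
Unset Printing Implicit Defensive.

Import Order.TTheory GRing.Theory Num.Theory.
Import numFieldNormedType.Exports.

Local Open Scope classical_set_scope.
Local Open Scope quotient_scope.
Local Open Scope ring_scope.

(* Two cells c <> d of the layer C'_j have the same image in N, under every
   presentation of N as a quotient of L: backward connectedness of L makes the
   projection L -> N unique and layer preserving.  So it suffices to find a
   branch b with b_c <> b_d near 0.

   Up to signs of f, of the state and of lambda, f satisfies f_00 < 0, f_i > 0
   and f_0lambda > 0.  Put b = 0 on the layers below C'_j and at c.  At any
   other cell, with inputs y >= 0, the map x |-> f(x, y, lambda) is strictly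
   concave near 0, nonnegative at 0 and at kappa * lambda, and negative at some
   fixed small positive x; hence it has a unique positive root, at which the
   x-derivative is negative, so the root depends smoothly on lambda > 0.

   Since |b_d - b_c| >= kappa |lambda|, and since this kind of bound is
   invariant under germ equivalence, no germ representative of b is trivial or
   has b_c = b_d. *)

(** * One-variable calculus *)

(** Chain rule along a curve, in coordinates: the differential of [f] applied to the velocity of
    [g], expanded in the basis [delta_mx ord0 i]. *)
Lemma is_derive1_partial (R : realType) n (f : 'rV[R]_n -> R)
    (g : R -> 'rV[R]_n) (dg : 'I_n -> R) (t : R) :
  differentiable f (g t) ->
  (forall i, is_derive t 1 (fun s => g s ord0 i) (dg i)) ->
  is_derive t 1 (fun s => f (g s)) (\sum_i dg i * partial i f (g t)).
Proof.
move=> df dgi.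
have dvg : derivable g t 1.
  by apply/derivable_mxP => i j; rewrite (ord1 i); exact: (@ex_derive _ _ _ _ _ _ _ (dgi j)).
have dfg : differentiable (f \o g) t.
  by apply: differentiable_comp => //; apply/derivable1_diffP.
have dgE : 'd g t 1 = \row_i dg i.
  rewrite -deriveE; last exact/derivable1_diffP.
  rewrite derive_mx//; apply/rowP => i; rewrite !mxE.
  exact: (@derive_val _ _ _ _ _ _ _ (dgi i)).
apply: DeriveDef; first exact/derivable1_diffP.
rewrite deriveE// diff_comp//=; last exact/derivable1_diffP.
rewrite dgE [X in 'd f (g t) X]row_sum_delta linear_sum.
apply: eq_bigr => i _; rewrite mxE linearZ /= /partial deriveE//.
Qed.

Lemma cvg_rV (R : realType) n (T : Type) (F : set_system T) (FF : Filter F)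
    (g : T -> 'rV[R]_n) (l : 'rV[R]_n) :
  (forall i, g t ord0 i @[t --> F] --> l ord0 i) -> g t @[t --> F] --> l.
Proof.
move=> gl; apply/cvg_ballP => e e0.
near=> t; split => // i j; rewrite (ord1 i).
by move: j; near: t; apply: filter_forall => j; exact: (cvg_ball (gl j)).
Unshelve. all: by end_near. Qed.

Lemma MVT_global (R : realType) (f df : R -> R) (a b : R) :
  (forall x : R, is_derive x 1 f (df x)) -> a < b ->
  exists2 c, a < c < b & f b - f a = df c * (b - a).
Proof.
move=> fd ab; have [|c] := @MVT R f df a b ab (fun x _ => fd x).
- apply: continuous_subspaceT => x; apply: differentiable_continuous.
  by apply/derivable1_diffP; exact: (@ex_derive _ _ _ _ _ _ _ (fd x)).
- by rewrite in_itv => cab E; exists c.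
Qed.

(** A decreasing [dF] stands for strict concavity. The mean slope from [a] to [r] is at most 0, so
    the slope at [r] is negative and stays so afterwards. A value [F x <= 0] before [r] would give a
    slope at most 0 followed by one at least 0. *)
Lemma concave_root (R : realType) (F dF : R -> R) (a b r : R) :
  (forall x : R, is_derive x 1 F (dF x)) ->
  (forall x y, a <= x -> x < y -> y <= b -> dF y < dF x) ->
  0 <= F a -> a < r -> r <= b -> F r = 0 ->
  [/\ dF r < 0, forall x, r < x -> x <= b -> F x < 0
    & forall x, a < x -> x < r -> 0 < F x].
Proof.
move=> FD dF_decr Fa ar rb Fr.
have dr : dF r < 0.
  have [c /andP[ac cr] E] := MVT_global FD ar.
  have : dF r < dF c by apply: dF_decr => //; exact: ltW.
  suff : dF c <= 0 by move=> *; lra.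
  have ra : 0 < r - a by rewrite subr_gt0.
  have : F r - F a <= 0 by lra.
  by rewrite E pmulr_lle0.
split => // x.
- move=> rx xb; have [c /andP[rc cx] E] := MVT_global FD rx.
  have dcr : dF c < dF r by apply: dF_decr => //; lra.
  have xr : 0 < x - r by rewrite subr_gt0.
  have : F x - F r < 0 by rewrite E pmulr_llt0 //; exact: lt_trans dr.
  by rewrite Fr subr0.
- move=> ax xr; rewrite ltNge; apply/negP => Fx.
  have [c /andP[ac cx] E] := MVT_global FD ax.
  have [d /andP[xd dr'] E'] := MVT_global FD xr.
  have dcd : dF d < dF c by apply: dF_decr; lra.
  have xa : 0 < x - a by rewrite subr_gt0.
  have rx : 0 < r - x by rewrite subr_gt0.
  have : F x - F a <= 0 by lra.
  rewrite E pmulr_lle0 // => dc.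
  have : 0 <= F r - F x by lra.
  rewrite E' pmulr_lge0 // => dd.
  lra.
Qed.

(** The derivative half of the implicit function theorem: a continuous solution [u] is already
    given. The mean value theorem in [x] turns the equation into
    [Fx (v t) t * (u t - u t0) = - F (u t0) t] with [v t] between [u t0] and [u t]; then divide by
    the increment of [t]. Continuity of [Fx] is only asked along curves [t |-> (v t, t)]. *)
Lemma implicit_derive (R : realType) (F Fx : R -> R -> R) (u : R -> R)
    (t0 Ft : R) :
  (\forall t \near t0, F (u t) t = 0) ->
  u t @[t --> t0] --> u t0 ->
  (forall x t : R, is_derive x 1 (F^~ t) (Fx x t)) ->
  (forall v : R -> R, v t @[t --> t0] --> u t0 ->
    Fx (v t) t @[t --> t0] --> Fx (u t0) t0) ->
  is_derive t0 1 (F (u t0)) Ft ->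
  Fx (u t0) t0 != 0 ->
  is_derive t0 1 u (- Ft / Fx (u t0) t0).
Proof.
move=> Fu uc FD FxC FtD Fx0.
have /choice[v vP] : forall t, exists z, `|u t0 - z| <= `|u t0 - u t| /\
    F (u t) t - F (u t0) t = Fx z t * (u t - u t0).
  move=> t; have [ut|ut|->] := ltgtP (u t0) (u t).
  - have [c /andP[c1 c2] E] := MVT_global (FD^~ t) ut; exists c; split => //.
    by rewrite !ler0_norm; lra.
  - have [c /andP[c1 c2] E] := MVT_global (FD^~ t) ut; exists c; split; last lra.
    by rewrite !ger0_norm; lra.
  - by exists (u t); rewrite !subrr mulr0.
have vc : v t @[t --> t0] --> u t0.
  apply/cvgrPdist_lt => e e0; move/cvgrPdist_lt : uc => /(_ e e0).
  by apply: filterS => t; apply: le_lt_trans; have [] := vP t.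
have {}FxC := FxC _ vc.
have Fv0 : \forall t \near t0, Fx (v t) t != 0.
  by move/cvgr_neq0 : FxC; exact.
have Fut0 : F (u t0) t0 = 0 by exact: (nbhs_singleton Fu).
(* The shifted argument exactly as it occurs in the difference quotient defining [derivable]; limits
   at [t0] are carried over to punctured neighborhoods of 0. *)
pose sh (h : R) : R := h%:A + t0.
have shift (P : R -> Prop) : (\forall t \near t0, P t) ->
    \forall h \near (0 : R)^', P (sh h).
  move=> /nbhs_ballP[e /= e0 Pe]; exists e => //= h.
  rewrite /ball/= sub0r normrN => he _; apply: Pe.
  by rewrite -ball_normE/= /sh [h%:A]mulr1 opprD addrCA subrr addr0 normrN.
have shiftc (G : R -> R) (l : R) : G t @[t --> t0] --> l ->
    G (sh h) @[h --> (0 : R)^'] --> l.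
  move=> /cvgrPdist_lt Gl; apply/cvgrPdist_lt => e e0.
  exact: (shift (fun t => `|l - G t| < e) (Gl e e0)).
have lim : h^-1 *: (u (sh h) - u t0) @[h --> (0 : R)^']
    --> - Ft / Fx (u t0) t0.
  have FtD' : h^-1 *: (F (u t0) (sh h) - F (u t0) t0) @[h --> (0 : R)^'] --> Ft.
    by case: FtD => FtD <-; exact: FtD.
  apply: cvg_trans; last first.
    exact: cvgM (cvgN FtD') (cvgV Fx0 (shiftc _ _ FxC)).
  apply: near_eq_cvg; near=> h => /=.
  have Fh : F (u (sh h)) (sh h) = 0.
    by near: h; exact: (shift (fun t => F (u t) t = 0)).
  have Fvh : Fx (v (sh h)) (sh h) != 0.
    by near: h; exact: (shift (fun t => Fx (v t) t != 0)).
  have [_] := vP (sh h); rewrite Fh sub0r => E.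
  change (- (h^-1 * (F (u t0) (sh h) - F (u t0) t0)) / Fx (v (sh h)) (sh h) =
    h^-1 * (u (sh h) - u t0)).
  by rewrite Fut0 subr0 -mulrN E -mulrA [_ / _]mulrAC mulfV ?mul1r.
apply: DeriveDef; first by apply/cvg_ex; exists (- Ft / Fx (u t0) t0).
exact/cvg_lim.
Unshelve. all: by end_near. Qed.

(** * Functions derivable up to a given order *)

(** Successive derivatives are witnesses valid on [A] only. This gives closure under algebraic
    operations and composition by induction on [n], without formulas for [derive1n]. *)
Fixpoint deriv_upto (R : realType) (n : nat) (A : set R) (g : R -> R) : Prop :=
  if n is n'.+1 then
    exists g' : R -> R,
      (forall x, A x -> is_derive x 1 g (g' x)) /\ deriv_upto n' A g'
  else True.

Section DerivUpto.
Variables (R : realType) (A : set R).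
Implicit Types (g h : R -> R) (n : nat).

Lemma deriv_uptoW n g : deriv_upto n.+1 A g -> deriv_upto n A g.
Proof.
elim: n g => //= n IH g [g' [gd [g2 g'd]]].
by exists g'; split => //; apply: IH; exists g2.
Qed.

Lemma deriv_upto_subset (B : set R) n g :
  B `<=` A -> deriv_upto n A g -> deriv_upto n B g.
Proof.
move=> BA; elim: n g => //= n IH g [g' [gd g'd]].
by exists g'; split; [move=> x /BA; exact: gd|exact: IH].
Qed.

Lemma deriv_upto_ext n g h : open A -> (forall x, A x -> g x = h x) ->
  deriv_upto n A g -> deriv_upto n A h.
Proof.
move=> Ao; case: n => //= n gh [g' [gd g'd]]; exists g'; split => // x Ax.
apply: near_eq_is_derive (gd _ Ax).
have : nbhs x A by apply: open_nbhs_nbhs.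
by apply: filterS.
Qed.

Lemma deriv_upto_cst n (c : R) : deriv_upto n A (fun=> c).
Proof.
elim: n c => //= n IH c; exists (fun=> 0); split; last exact: IH.
by move=> x _; exact: is_derive_cst.
Qed.

Lemma deriv_upto_id n : deriv_upto n A id.
Proof.
case: n => //= n; exists (fun=> 1); split; last exact: deriv_upto_cst.
by move=> x _; exact: is_derive_id.
Qed.

Lemma deriv_uptoD n g h : deriv_upto n A g -> deriv_upto n A h ->
  deriv_upto n A (fun x => g x + h x).
Proof.
elim: n g h => //= n IH g h [g' [gd g'd]] [h' [hd h'd]].
exists (fun x => g' x + h' x); split; last exact: IH.
by move=> x Ax; apply: is_deriveD; [exact: gd|exact: hd].
Qed.

Lemma deriv_uptoN n g :
  deriv_upto n A g -> deriv_upto n A (fun x => - g x).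
Proof.
elim: n g => //= n IH g [g' [gd g'd]].
exists (fun x => - g' x); split; last exact: IH.
by move=> x Ax; apply: is_deriveN; exact: gd.
Qed.

Lemma deriv_upto_sum (I : Type) (r : seq I) n (g : I -> R -> R) :
  (forall i, deriv_upto n A (g i)) ->
  deriv_upto n A (fun x => \sum_(i <- r) g i x).
Proof.
move=> gd; elim: r => [|i r IH].
  by under eq_fun do rewrite big_nil; exact: deriv_upto_cst.
by under eq_fun do rewrite big_cons; exact: deriv_uptoD.
Qed.

Lemma deriv_uptoM n g h : deriv_upto n A g -> deriv_upto n A h ->
  deriv_upto n A (fun x => g x * h x).
Proof.
elim: n g h => // n IH g h gd hd.
have [gdW hdW] := (deriv_uptoW gd, deriv_uptoW hd).
move: gd hd => [g' [gd g'd]] [h' [hd h'd]].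
exists (fun x => g x * h' x + h x * g' x); split.
  by move=> x Ax; apply: is_deriveM; [exact: gd|exact: hd].
by apply: deriv_uptoD; exact: IH.
Qed.

Lemma deriv_uptoV n g : (forall x, A x -> g x != 0) ->
  deriv_upto n A g -> deriv_upto n A (fun x => (g x)^-1).
Proof.
move=> g0; elim: n => // n IH gd.
have Vd := IH (deriv_uptoW gd).
move: gd => [g' [gd g'd]].
exists (fun x => -1 * ((g x)^-1 * (g x)^-1) * g' x); split.
  move=> x Ax; have [gx gxE] := gd _ Ax; apply: DeriveDef.
    exact: derivableV (g0 _ Ax) gx.
  rewrite (deriveV (g0 _ Ax) gx) gxE.
  by rewrite -[_ *: _]/(_ * _) expr2 invfM mulN1r.
by do 3?apply: deriv_uptoM => //; exact: deriv_upto_cst.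
Qed.

(** On an open set each witness agrees near every point with the actual derivative, so it can be
    replaced by it. *)
Lemma deriv_upto_smooth_on g : open A -> (forall n, deriv_upto n A g) ->
  smooth_on A g.
Proof.
move=> Ao + n; suff H m : deriv_upto m.+1 A g ->
    forall x, A x -> derivable (derive1n m g) x 1 by move=> gd; exact: H.
elim: m g => [|m IH] g.
  by move=> [g' [gd _]] x Ax; exact: (@ex_derive _ _ _ _ _ _ _ (gd _ Ax)).
move=> [g' [gd g'd]] x Ax; rewrite derive1Sn; apply: IH => //.
apply: (@deriv_upto_ext m.+1 g' _ Ao) g'd => y Ay.
by rewrite derive1E; apply/esym; exact: (@derive_val _ _ _ _ _ _ _ (gd _ Ay)).
Qed.

Lemma smooth_partial p (f : 'rV[R]_p -> R) i :
  smooth f -> smooth (partial i f).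
Proof. by move=> fs s x; have := fs (rcons s i) x; rewrite foldr_rcons. Qed.

Lemma smooth_differentiable p (f : 'rV[R]_p -> R) x :
  smooth f -> differentiable f x.
Proof. by move=> fs; exact: (fs [::]). Qed.

Lemma smooth_continuous p (f : 'rV[R]_p -> R) :
  smooth f -> continuous f.
Proof. by move=> fs x; apply/differentiable_continuous/smooth_differentiable. Qed.

(** The induction is over all smooth [f], since the chain rule brings in the partial derivatives of
    [f] along the same curve. *)
Lemma deriv_upto_comp n p (f : 'rV[R]_p -> R) (g : R -> 'rV[R]_p) :
  smooth f -> (forall i, deriv_upto n A (fun t => g t ord0 i)) ->
  deriv_upto n A (fun t => f (g t)).
Proof.
elim: n f => // n IH f fs gd.
have gdW i := deriv_uptoW (gd i).
have /choice[g' g'P] := gd.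
exists (fun t => \sum_i g' i t * partial i f (g t)); split.
  move=> x Ax; apply: is_derive1_partial; first exact: smooth_differentiable.
  by move=> i; have [+ _] := g'P i; apply.
apply: deriv_upto_sum => i; apply: deriv_uptoM; first by have [] := g'P i.
by apply: IH => //; exact: smooth_partial.
Qed.

End DerivUpto.

(** * Fold normal form *)

Definition idxl k : 'I_(1 + (k + 1)) := rshift 1 (rshift k ord0).

Section Inputs.
Variables (R : realType) (k : nat).

(** The inputs from other cells form a function on edge types, so that a family of curves [y] is
    evaluated at time [s] as [y^~ s]. *)
Definition arg (x : R) (y : 'I_k -> R) (t : R) : inputs R k :=
  mk_inputs x (\row_i y i) t.

Lemma arg_idx0 x y t : arg x y t ord0 (idx0 k) = x.
Proof. by rewrite /arg /mk_inputs row_mxEl mxE eqxx mulr1n. Qed.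

Lemma arg_idx x y t i : arg x y t ord0 (idx i) = y i.
Proof. by rewrite /arg /mk_inputs row_mxEr row_mxEl mxE. Qed.

Lemma arg_idxl x y t : arg x y t ord0 (idxl k) = t.
Proof. by rewrite /arg /mk_inputs !row_mxEr mxE eqxx mulr1n. Qed.

Lemma inputs_ind (P : 'I_(1 + (k + 1)) -> Prop) :
  P (idx0 k) -> (forall i, P (idx i)) -> P (idxl k) -> forall i, P i.
Proof.
move=> P0 Pi Pl i; case: (split_ordP i) => j ->.
  by rewrite (ord1 j).
by case: (split_ordP j) => j' ->; [exact: Pi|rewrite (ord1 j')].
Qed.

Lemma sum_inputs (F : 'I_(1 + (k + 1)) -> R) :
  \sum_i F i = F (idx0 k) + (\sum_i F (idx i) + F (idxl k)).
Proof. by rewrite big_split_ord big_ord1 big_split_ord /= big_ord1. Qed.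

Lemma arg_zero t : arg 0 (fun=> 0) t = mk_inputs 0 0 t.
Proof.
by rewrite /arg (_ : \row__ 0 = 0) //; apply/rowP => i; rewrite !mxE.
Qed.

Lemma mk_inputs0 : mk_inputs 0 0 0 = 0 :> inputs R k.
Proof. by rewrite /mk_inputs !raddf0 !row_mx0. Qed.

Lemma ball0_arg x y t (d : R) : 0 < d ->
  `|x| < d -> (forall i, `|y i| < d) -> `|t| < d -> ball 0 d (arg x y t).
Proof.
move=> d0 xd yd td; split => // i j; rewrite (ord1 i) mxE -ball_normE /=; move: j.
by apply: inputs_ind => [|j|]; rewrite sub0r normrN
  ?arg_idx0 ?arg_idx ?arg_idxl.
Qed.

Lemma fun_arg (T : Type) (x t : T -> R) (y : 'I_k -> T -> R) :
  [/\ (fun s => arg (x s) (y^~ s) (t s) ord0 (idx0 k)) = x,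
      forall i, (fun s => arg (x s) (y^~ s) (t s) ord0 (idx i)) = y i
    & (fun s => arg (x s) (y^~ s) (t s) ord0 (idxl k)) = t].
Proof.
by split=> [|i|]; apply/funext => s; rewrite ?arg_idx0 ?arg_idx ?arg_idxl.
Qed.

Lemma cvg_arg (T : Type) (F : set_system T) (FF : Filter F)
    (f : inputs R k -> R) (x t : T -> R) (y : 'I_k -> T -> R) x0 y0 t0 :
  continuous f ->
  x s @[s --> F] --> x0 -> (forall i, y i s @[s --> F] --> y0 i) ->
  t s @[s --> F] --> t0 ->
  f (arg (x s) (y^~ s) (t s)) @[s --> F] --> f (arg x0 y0 t0).
Proof.
move=> fc xc yc tc; pose g s := arg (x s) (y^~ s) (t s).
suff gc : g s @[s --> F] --> arg x0 y0 t0 by exact: cvg_comp gc (fc _).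
have [E0 Ei El] := fun_arg x t y; rewrite /g; apply: cvg_rV; apply: inputs_ind => [|i|].
- by rewrite E0 arg_idx0.
- by rewrite Ei arg_idx.
- by rewrite El arg_idxl.
Qed.

Lemma deriv_upto_arg n (A : set R) (f : inputs R k -> R) (x t : R -> R)
    (y : 'I_k -> R -> R) : smooth f ->
  deriv_upto n A x -> (forall i, deriv_upto n A (y i)) -> deriv_upto n A t ->
  deriv_upto n A (fun s => f (arg (x s) (y^~ s) (t s))).
Proof.
move=> fs xd yd td; have [E0 Ei El] := fun_arg x t y; apply: deriv_upto_comp => //.
apply: inputs_ind => [|i|].
- by rewrite E0.
- by rewrite Ei.
- by rewrite El.
Qed.

Lemma is_derive_arg (f : inputs R k -> R) (x t : R -> R) (y : 'I_k -> R -> R)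
    (dx dt : R) (dy : 'I_k -> R) (s : R) : smooth f ->
  is_derive s 1 x dx -> (forall i, is_derive s 1 (y i) (dy i)) ->
  is_derive s 1 t dt ->
  is_derive s 1 (fun s => f (arg (x s) (y^~ s) (t s)))
    (dx * partial (idx0 k) f (arg (x s) (y^~ s) (t s)) +
      (\sum_i dy i * partial (idx i) f (arg (x s) (y^~ s) (t s)) +
       dt * partial (idxl k) f (arg (x s) (y^~ s) (t s)))).
Proof.
move=> fs xd yd td; have [E0 Ei El] := fun_arg x t y.
have := @is_derive1_partial R _ f (fun s => arg (x s) (y^~ s) (t s))
  (arg dx dy dt ord0) s (smooth_differentiable _ fs).
rewrite sum_inputs arg_idx0 arg_idxl.
under eq_bigr do rewrite arg_idx.
apply; apply: inputs_ind => [|i|].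
- by rewrite E0 arg_idx0.
- by rewrite Ei arg_idx.
- by rewrite El arg_idxl.
Qed.

Lemma is_derive_arg0 (f : inputs R k -> R) (y : 'I_k -> R) (t x : R) :
  smooth f ->
  is_derive x 1 (fun x => f (arg x y t)) (partial (idx0 k) f (arg x y t)).
Proof.
move=> fs; have := @is_derive_arg f id (fun=> t) (fun i _ => y i) 1 0
  (fun=> 0) x fs _ (fun i => is_derive_cst _ _ _) _.
by rewrite big1 => [|i _]; rewrite ?mul0r // !addr0 mul1r; apply.
Qed.

End Inputs.

Definition in_box (R : realType) k (d x : R) (y : 'I_k -> R) (t : R) : Prop :=
  [/\ `|x| < d, forall i, `|y i| < d & `|t| < d].

(* The last condition is d/dt h_0(kappa t, 0, t) > 0; it places the nontrivial
   zero of h(., 0, t) above kappa * t for small t > 0. *)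
Record fold_form (R : realType) k (h : inputs R k -> R) (d kappa : R) : Prop := {
  fold_smooth : smooth h;
  fold_zero : forall t, h (arg 0 (fun=> 0) t) = 0;
  fold_crit : partial (idx0 k) h 0 = 0;
  fold_d_gt0 : 0 < d;
  fold_kappa_gt0 : 0 < kappa;
  fold_xx : forall x y t, in_box d x y t ->
    partial (idx0 k) (partial (idx0 k) h) (arg x y t) < 0;
  fold_y : forall x y t, in_box d x y t ->
    forall i, 0 < partial (idx i) h (arg x y t);
  fold_xt : forall x y t, in_box d x y t ->
    0 < kappa * partial (idx0 k) (partial (idx0 k) h) (arg x y t) +
        partial (idxl k) (partial (idx0 k) h) (arg x y t) }.

Section FoldForm.
Variables (R : realType) (k : nat) (h : inputs R k -> R) (d kappa : R).
Hypothesis hF : fold_form h d kappa.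

Let h0 := partial (idx0 k) h.
Let hs : smooth h := fold_smooth hF.
Let h0s : smooth h0 := smooth_partial _ hs.

Lemma fold_decr (y : 'I_k -> R) (t x1 x2 : R) :
  (forall i, `|y i| < d) -> `|t| < d -> 0 <= x1 -> x1 < x2 -> x2 < d ->
  h0 (arg x2 y t) < h0 (arg x1 y t).
Proof.
move=> yd td x10 x12 x2d.
have [c /andP[c1 c2] E] := MVT_global (fun x => is_derive_arg0 y t x h0s) x12.
have cd : `|c| < d by rewrite ger0_norm; lra.
have x21 : 0 < x2 - x1 by rewrite subr_gt0.
by rewrite -subr_lt0 E pmulr_llt0 //; apply: (fold_xx hF).
Qed.

(** Mean value theorem along the segment [s |-> s * y] from 0 to [y]: the derivative is a sum of the
    [y i] times positive partial derivatives. *)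
Lemma fold_mono_y (x t : R) (y : 'I_k -> R) : in_box d x y t ->
  (forall i, 0 <= y i) -> h (arg x (fun=> 0) t) <= h (arg x y t).
Proof.
move=> [xd yd td] y0.
have D s := @is_derive_arg _ _ h (fun=> x) (fun=> t) (fun i s => s * y i) 0 0 y
  s hs (is_derive_cst _ _ _).
have {}D (s : R) : is_derive s 1 (fun s => h (arg x (fun i => s * y i) t))
    (\sum_i y i * partial (idx i) h (arg x (fun i => s * y i) t)).
  have := D s; rewrite !mul0r addr0 add0r; apply.
  move=> i; have := is_deriveM (is_derive_id s 1) (is_derive_cst (y i) s 1).
  by rewrite scaler0 add0r => H; apply: is_derive_eq; rewrite -[_ *: _]/(_ * _) mulr1.
have [c /andP[c0 c1] E] := MVT_global D ltr01.
rewrite -subr_ge0.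
have -> : h (arg x y t) - h (arg x (fun=> 0) t) =
    h (arg x (fun i => 1 * y i) t) - h (arg x (fun i => 0 * y i) t).
  by congr (h _ - h _); congr arg; apply/funext => i; rewrite ?mul1r ?mul0r.
rewrite E subr0 mulr1; apply: sumr_ge0 => i _; apply: mulr_ge0 => //.
apply/ltW/(fold_y hF); split => // j.
rewrite normrM gtr0_norm //; apply: le_lt_trans (yd j).
by rewrite ler_piMl // ltW.
Qed.

(** The function [t |-> h0(kappa t, 0, t)] vanishes at 0 and increases by [fold_xt], so it is
    positive at [s]. As [h0] decreases in [x], it is positive on all of [0, kappa s], and
    [h(., 0, s)] grows there from its value 0 at 0. *)
Lemma fold_ge0 (s : R) : 0 <= s -> s < d -> kappa * s < d ->
  0 <= h (arg (kappa * s) (fun=> 0) s).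
Proof.
rewrite le_eqVlt => /orP[/eqP<- _ _|s0 sd ksd].
  by rewrite mulr0 (fold_zero hF).
have hc : h0 0 = 0 := fold_crit hF.
have k0 := fold_kappa_gt0 hF; have d0 := fold_d_gt0 hF.
have ks0 : 0 < kappa * s by exact: mulr_gt0.
have box (x t : R) : 0 <= x -> x <= kappa * s -> 0 <= t -> t <= s ->
    in_box d x (fun _ : 'I_k => 0) t.
  move=> x0 xk t0 ts; split=> [|_|]; rewrite ?normr0 // ger0_norm //.
  - exact: le_lt_trans ksd.
  - exact: le_lt_trans sd.
have WD (t : R) : is_derive t 1 (fun t => h0 (arg (kappa * t) (fun=> 0) t))
    (kappa * partial (idx0 k) h0 (arg (kappa * t) (fun=> 0) t) +
     partial (idxl k) h0 (arg (kappa * t) (fun=> 0) t)).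
  have kD : is_derive t 1 (fun t => kappa * t) kappa.
    have := is_deriveZ kappa (is_derive_id t 1).
    by rewrite -[_ *: 1]/(_ * 1) mulr1.
  have := is_derive_arg h0s kD (fun _ => is_derive_cst 0 t 1) (is_derive_id t 1).
  by rewrite big1 ?add0r ?mul1r // => i _; rewrite mul0r.
have W0 : 0 < h0 (arg (kappa * s) (fun=> 0) s).
  have [c /andP[c0 cs]] := MVT_global WD s0.
  rewrite mulr0 arg_zero mk_inputs0 hc !subr0 => ->.
  apply: mulr_gt0 => //; apply: (fold_xt hF); apply: box => //; try exact: ltW.
  - by apply: mulr_ge0; exact: ltW.
  - by rewrite ler_pM2l //; exact: ltW.
have [c /andP[c0 cs]] := MVT_global (is_derive_arg0 (fun=> 0) s ^~ hs) ks0.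
rewrite (fold_zero hF) !subr0 => ->; apply: mulr_ge0; last exact: ltW.
have [_ zd sd'] : in_box d 0 (fun _ : 'I_k => 0) s by apply: box => //; exact: ltW.
by apply/ltW/(lt_trans W0); apply: fold_decr => //; exact: ltW.
Qed.

(** At [t = 0] and [y = 0] the slope in [x] starts at 0 and decreases strictly. *)
Lemma fold_lt0 (x : R) : 0 < x -> x < d -> h (arg x (fun=> 0) 0) < 0.
Proof.
move=> x0 xd; have d0 := fold_d_gt0 hF.
have [c /andP[c0 cx]] := MVT_global (is_derive_arg0 (fun=> 0) 0 ^~ hs) x0.
rewrite (fold_zero hF) !subr0 => ->; rewrite pmulr_llt0 //.
have h00 : h0 (arg 0 (fun=> 0) 0) = 0.
  by rewrite arg_zero mk_inputs0; exact: fold_crit hF.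
rewrite -[ltRHS]h00; apply: fold_decr => // [_| |]; rewrite ?normr0 //.
exact: lt_trans xd.
Qed.

End FoldForm.

(** * Solution curves of a single cell *)

(* Curves are continuous on both sides of 0, because the equations they solve
   below involve |t| in place of t; they are smooth only for t > 0. *)
Record curve (R : realType) (r : R) (u : R -> R) : Prop := {
  curve0 : u 0 = 0;
  curve_ge0 : forall t, `|t| < r -> 0 <= u t;
  curve_cvg : forall t, `|t| < r -> u s @[s --> t] --> u t;
  curve_deriv : forall n, deriv_upto n `]0, r[ u }.

Lemma curveW (R : realType) (r r' : R) u : r' <= r -> curve r u -> curve r' u.
Proof.
move=> rr [u0 uge uc ud]; split => // [t|t|n].
- by move=> tr; apply: uge; exact: lt_le_trans rr.
- by move=> tr; apply: uc; exact: lt_le_trans rr.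
- apply: deriv_upto_subset (ud n) => t /=; rewrite !in_itv /= => /andP[-> tr].
  exact: lt_le_trans rr.
Qed.

Section Solve.
Variables (R : realType) (k : nat) (h : inputs R k -> R) (d kappa : R).
Hypothesis hF : fold_form h d kappa.
Variables (r : R) (y : 'I_k -> R -> R).
Hypotheses (r_gt0 : 0 < r) (yP : forall i, curve r (y i)).

Let F (t x : R) : R := h (arg x (y^~ t) `|t|).
Let e : R := d / 2.
(** The times at which [F t] is strictly concave on [0, e] and changes sign between [kappa * |t|]
    and [e]. Taking [e = d / 2] keeps the closed interval inside the box. *)
Let small (t : R) : Prop :=
  [/\ `|t| < r, forall i, `|y i t| < d, `|t| < d, kappa * `|t| <= e & F t e < 0].

Let d_gt0 : 0 < d := fold_d_gt0 hF.
Let ed : 0 < e < d. Proof. by rewrite /e; have := d_gt0; lra. Qed.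

Let y_at0 : (fun i => y i 0) = fun=> 0.
Proof. by apply/funext => i; exact: curve0 (yP i). Qed.

Let F_cvg (t x : R) : `|t| < r -> F s x @[s --> t] --> F t x.
Proof.
move=> tr; apply: cvg_arg; first exact: smooth_continuous (fold_smooth hF).
- exact: cvg_cst.
- by move=> i; exact: curve_cvg (yP i) _ tr.
- exact: norm_continuous.
Qed.

Let F_lt0 (x : R) : 0 < x -> x < d -> F 0 x < 0.
Proof. by rewrite /F normr0 y_at0; exact: fold_lt0 hF x. Qed.

Let near_small : \forall t \near (0 : R), small t.
Proof.
have [e0 ed'] := andP ed; have k0 := fold_kappa_gt0 hF.
have n0 (c : R) : 0 < c -> \forall t \near (0 : R), `|t| < c.
  by move=> c0; exact: (@nbhs0_lt R R c c0).
near=> t; split.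
- by near: t; apply: n0.
- near: t; apply: filter_forall => i.
  have /cvgrPdist_lt/(_ d d_gt0) : y i s @[s --> 0] --> 0.
    by rewrite -[X in _ --> X](curve0 (yP i)); apply: (curve_cvg (yP i)); rewrite normr0.
  by apply: filterS => s; rewrite sub0r normrN.
- by near: t; apply: n0.
- rewrite mulrC -ler_pdivlMr //; apply: ltW; near: t; apply: n0; exact: divr_gt0.
- near: t; apply: (cvgr_lt (F 0 e)); last exact: F_lt0.
  by apply: F_cvg; rewrite normr0.
Unshelve. all: by end_near. Qed.

(** Intermediate values: [F t] is nonnegative at [kappa * |t|], by [fold_ge0] and monotonicity in
    the nonnegative inputs, and negative at [e]. *)
Let exists_root (t : R) : small t ->
  exists x, [/\ kappa * `|t| <= x, x <= e & F t x = 0].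
Proof.
move=> [tr yd td kt Fe]; have [e0 ed'] := andP ed.
have k0 := fold_kappa_gt0 hF.
have kt0 : 0 <= kappa * `|t| by rewrite mulr_ge0 // ltW.
have Fk : 0 <= F t (kappa * `|t|).
  have kd : kappa * `|t| < d by exact: le_lt_trans ed'.
  apply: le_trans (fold_mono_y hF _ _); first exact: fold_ge0 hF _ _ _ _.
  - by split => //; [rewrite ger0_norm|rewrite normr_id].
  - by move=> i; exact: curve_ge0 (yP i) _ tr.
have [||x] := @IVT R (F t) (kappa * `|t|) e 0 kt.
- apply: continuous_subspaceT => x; apply: differentiable_continuous.
  apply/derivable1_diffP.
  exact: (@ex_derive _ _ _ _ _ _ _ (is_derive_arg0 _ _ _ (fold_smooth hF))).
- by rewrite ge_min le_max Fk (ltW Fe) orbT.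
by rewrite in_itv /= => /andP[kx xe] Fx; exists x.
Qed.

(** [concave_root] on [0, e]; the value at 0 is nonnegative because raising the inputs from 0 to [y]
    can only increase [h(0, 0, |t|) = 0]. *)
Let root_unique (t x : R) : small t -> 0 < x -> x <= e -> F t x = 0 ->
  [/\ partial (idx0 k) h (arg x (y^~ t) `|t|) < 0,
      forall z, x < z -> z <= e -> F t z < 0 &
      forall z, 0 < z -> z < x -> 0 < F t z].
Proof.
move=> [tr yd td kt Fe] x0 xe Fx; have [e0 ed'] := andP ed.
have F0 : 0 <= F t 0.
  rewrite -[leLHS](fold_zero hF `|t|) /F; apply: (fold_mono_y hF).
    by split; rewrite ?normr0 ?normr_id.
  by move=> i; exact: curve_ge0 (yP i) _ tr.
apply: (@concave_root R (F t)
  (fun x => partial (idx0 k) h (arg x (y^~ t) `|t|)) 0 e x) => //.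
- by move=> z; exact: is_derive_arg0 (fold_smooth hF).
- move=> z1 z2 z10 z12 z2e; apply: (fold_decr hF) => //; first by rewrite normr_id.
  exact: le_lt_trans ed'.
Qed.

(** A root is chosen separately for every [t]. The sign pattern of [F t] around its positive root
    makes the choice continuous, and implicit differentiation then makes it smooth for [t > 0]. *)
Lemma fold_solve : exists u r', [/\ 0 < r' <= r, curve r' u,
  forall t, `|t| < r' -> h (arg (u t) (y^~ t) `|t|) = 0 &
  forall t, `|t| < r' -> kappa * `|t| <= u t].
Proof.
have [e0 ed'] := andP ed; have k0 := fold_kappa_gt0 hF.
have /choice[u uP] : forall t, exists x, small t ->
    [/\ kappa * `|t| <= x, x <= e & F t x = 0].
  move=> t; have [/exists_root[x xP]|nt] := pselect (small t); first by exists x.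
  by exists 0.
have [r' r'0 r'P] : exists2 r' : R, 0 < r' & forall t, `|t| < r' -> small t.
  have /nbhs_ballP[r' r'0 H] := near_small; exists r' => // t tr.
  by apply: H; rewrite -ball_normE /= sub0r normrN.
have rr : Num.min r' r <= r' by rewrite ge_min lexx.
have {}uP (t : R) : `|t| < r' -> [/\ kappa * `|t| <= u t, u t <= e & F t (u t) = 0].
  by move=> /r'P/uP.
have u_ge0 (t : R) : `|t| < r' -> 0 <= u t.
  by move=> /uP[ku _ _]; apply: le_trans ku; rewrite mulr_ge0 // ltW.
have u_gt0 (t : R) : `|t| < r' -> t != 0 -> 0 < u t.
  move=> /uP[ku _ _] t0; apply: lt_le_trans ku.
  by rewrite mulr_gt0 ?normr_gt0.
(* A positive value would be a zero of [F 0] in ]0, d[, where [F 0] is negative. *)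
have u0 : u 0 = 0.
  have tr : `|0 : R| < r' by rewrite normr0.
  have [_ ue Fu] := uP _ tr; apply/eqP; rewrite eq_le u_ge0 // andbT leNgt.
  apply/negP => up; have := F_lt0 up (le_lt_trans ue ed').
  by rewrite Fu ltxx.
have near_lt (t : R) : `|t| < r' -> \forall s \near t, `|s| < r'.
  by move=> tr; move: (@norm_continuous R R t) => /cvgr_lt; apply.
have uc (t : R) : `|t| < r' -> u s @[s --> t] --> u t.
  move=> tr; have tr0 : `|t| < r by case: (r'P _ tr).
  have [ku ue Fu] := uP _ tr.
  apply/cvgrPdist_lt => eta eta0.
  (* Just above [u t] the function [F t] is negative, and so is [F s] for [s] near [t]; since [F s]
     is positive on ]0, u s[, the root [u s] lies below. If the test point exceeds [e], the bound
     [u s <= e] suffices. At [t = 0] the sign comes from [F_lt0], as [u 0] is not a positive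
     root. *)
  have up : \forall s \near t, u s < u t + eta.
    have [ze|ze] := leP (u t + eta / 2) e; last first.
      near=> s; have [//|_ us _] := uP s; first by near: s; exact: near_lt.
      by apply: le_lt_trans us _; apply: lt_trans ze _; lra.
    set z := u t + eta / 2 in ze.
    have z0 : 0 < z by rewrite /z; have := u_ge0 _ tr; lra.
    have Fz : F t z < 0.
      have [t0|t0] := eqVneq t 0.
        by rewrite t0; apply: F_lt0 => //; exact: le_lt_trans ed'.
      have [_ + _] := root_unique (r'P _ tr) (u_gt0 _ tr t0) ue Fu; apply => //.
      by rewrite /z; lra.
    near=> s.
    have sr : `|s| < r' by near: s; exact: near_lt.
    have Fsz : F s z < 0 by near: s; apply: (cvgr_lt (F t z)) => //; exact: F_cvg.
    suff : u s < z by move=> /lt_trans; apply; rewrite /z; lra.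
    have [->|s0] := eqVneq s 0; first by rewrite u0.
    have [_ use Fus] := uP _ sr.
    have [_ _ H] := root_unique (r'P _ sr) (u_gt0 _ sr s0) use Fus.
    have [//|zu|zu] := ltgtP (u s) z; first by have := H _ z0 zu; lra.
    by move: Fsz; rewrite -zu Fus ltxx.
  (* The mirror argument with a test point below [u t]. If that point is not positive, [u s >= 0]
     suffices; otherwise [u t > 0], which forces [t] to be nonzero. *)
  have lo : \forall s \near t, u t - eta < u s.
    set z := u t - eta / 2.
    have [z0|z0] := leP z 0.
      near=> s.
      have sr : `|s| < r' by near: s; exact: near_lt.
      by have := u_ge0 _ sr; move: z0; rewrite /z; lra.
    have t0 : t != 0.
      by move: z0; rewrite /z; apply: contraTN => /eqP ->; rewrite u0 -leNgt; lra.
    have Fz : 0 < F t z.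
      have [_ _ +] := root_unique (r'P _ tr) (u_gt0 _ tr t0) ue Fu; apply => //.
      by rewrite /z; lra.
    near=> s.
    have sr : `|s| < r' by near: s; exact: near_lt.
    have Fsz : 0 < F s z by near: s; apply: (cvgr_gt (F t z)) => //; exact: F_cvg.
    suff : z < u s by apply: lt_trans; rewrite /z; lra.
    have ze : z <= e by rewrite /z; lra.
    have s0 : s != 0.
      apply: contraTN Fsz => /eqP ->; rewrite -leNgt ltW //.
      by apply: F_lt0 => //; exact: le_lt_trans ed'.
    have [_ use Fus] := uP _ sr.
    have [_ H _] := root_unique (r'P _ sr) (u_gt0 _ sr s0) use Fus.
    have [//|zu|zu] := ltgtP z (u s); first by have := H _ zu ze; lra.
    by move: Fsz; rewrite zu Fus ltxx.
  near=> s; rewrite ltr_distlC.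
  by apply/andP; split; near: s.
exists u, (Num.min r' r); split.
- by rewrite lt_min r'0 r_gt0 ge_min lexx orbT.
- apply: (curveW rr); split => // n.
  (* On this interval [|t| = t], so the absolute value disappears from the equation before it is
     differentiated. *)
  pose A : set R := `]0, r'[%classic.
  have Ao : open A by exact: itv_open.
  have AP (t : R) : A t -> [/\ `|t| < r', t != 0 & `|t| = t].
    rewrite /A /= in_itv /= => /andP[t0 tr]; rewrite gt_eqF // gtr0_norm //.
  have yd i m : deriv_upto m A (y i).
    apply: (deriv_upto_subset _ (curve_deriv (yP i) m)) => t At.
    have [tr t0 tE] := AP _ At; have [tr' _ _ _ _] := r'P _ tr.
    by move: At tr'; rewrite tE /A /= !in_itv /= => /andP[-> _] ->.
  have Xd f m : smooth f -> deriv_upto m A u ->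
      deriv_upto m A (fun t => f (arg (u t) (y^~ t) t)).
    by move=> fs ud; apply: deriv_upto_arg => //; exact: deriv_upto_id.
  have hs := fold_smooth hF.
  (* Implicit differentiation expresses the derivative of [u] through [u], the [y i] and their
     derivatives, so [n] derivatives of [u] yield [n] derivatives of [u']. *)
  elim: n => // n IH.
  have /choice[y' y'P] : forall i, exists y' : R -> R,
      (forall x, A x -> is_derive x 1 (y i) (y' x)) /\ deriv_upto n A y'.
    by move=> i; exact: (yd i n.+1).
  exists (fun t => - (\sum_i y' i t * partial (idx i) h (arg (u t) (y^~ t) t) +
      partial (idxl k) h (arg (u t) (y^~ t) t)) /
      partial (idx0 k) h (arg (u t) (y^~ t) t)); split; last first.
    apply: deriv_uptoM; last first.
      apply: deriv_uptoV; last exact: Xd (smooth_partial _ hs) IH.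
      move=> t /AP[tr t0 tE]; have [_ ue Fu] := uP _ tr.
      have [+ _ _] := root_unique (r'P _ tr) (u_gt0 _ tr t0) ue Fu.
      by rewrite tE => /lt_eqF ->.
    apply: deriv_uptoN; apply: deriv_uptoD; last exact: Xd (smooth_partial _ hs) IH.
    apply: deriv_upto_sum => i; apply: deriv_uptoM; first by have [] := y'P i.
    exact: Xd (smooth_partial _ hs) IH.
  move=> t At; have [tr t0 tE] := AP _ At.
  have [_ ue Fu] := uP _ tr.
  apply: (@implicit_derive R (fun x t => h (arg x (y^~ t) t))
    (fun x t => partial (idx0 k) h (arg x (y^~ t) t))) => //.
  + near=> s.
    have As : A s by near: s; apply: open_nbhs_nbhs.
    have [sr s0 sE] := AP _ As; have [_ _] := uP _ sr.
    by rewrite /F sE.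
  + exact: uc.
  + by move=> x s; exact: is_derive_arg0.
  + move=> v vt; apply: cvg_arg => //.
    * exact: smooth_continuous (smooth_partial _ hs).
    * move=> i; have [tr' _ _ _ _] := r'P _ tr; exact: curve_cvg (yP i) _ tr'.
  + have := is_derive_arg hs (is_derive_cst (u t) t 1)
      (fun i => (y'P i).1 t At) (is_derive_id t 1).
    by rewrite mul0r add0r mul1r.
  + have [+ _ _] := root_unique (r'P _ tr) (u_gt0 _ tr t0) ue Fu.
    by rewrite tE => /lt_eqF ->.
- by move=> t tr; have [] := uP _ (lt_le_trans tr rr).
- by move=> t tr; have [] := uP _ (lt_le_trans tr rr).
Unshelve. all: by end_near. Qed.

End Solve.

(** * Solution curves of a network *)

Lemma common_radius (R : realType) (T : finType) (Q : T -> R -> Prop) :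
  (forall c r r', r' <= r -> Q c r -> Q c r') ->
  (forall c, exists2 r, 0 < r & Q c r) ->
  exists2 r, 0 < r & forall c, Q c r.
Proof.
move=> Qw Qe.
suff [r r0 rP] : exists2 r, 0 < r & forall c, c \in enum T -> Q c r.
  by exists r => // c; apply: rP; rewrite mem_enum.
elim: (enum T) => [|c s [r r0 rP]]; first by exists 1.
have [r' r'0 Qc] := Qe c; exists (Num.min r r'); first by rewrite lt_min r0.
move=> c'; rewrite inE => /orP[/eqP->|/rP].
- by apply: Qw Qc; rewrite ge_min lexx orbT.
- by apply: Qw; rewrite ge_min lexx.
Qed.

Lemma curve_cst0 (R : realType) (r : R) : curve r (fun=> 0).
Proof.
split => // [t _|n]; [exact: cvg_cst|exact: deriv_upto_cst].
Qed.

Section FoldNetwork.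
Variables (R : realType) (k : nat) (h : inputs R k -> R) (d kappa : R).
Hypothesis hF : fold_form h d kappa.
Variables (L : network k) (rank : cell L -> nat) (Z : pred (cell L)).
Hypotheses (Z_src : forall c i, Z c -> Z (src i c))
  (rank_src : forall c i, ~~ Z c -> (rank (src i c) < rank c)%N).

Let solution (r : R) (y : 'I_k -> R -> R) (u : R -> R) : Prop :=
  [/\ curve r u,
      forall t, `|t| < r -> h (arg (u t) (y^~ t) `|t|) = 0 &
      forall t, `|t| < r -> kappa * `|t| <= u t].

(** The hypothesis on [y] stands under the existential, so that choice yields one total solution
    operator on families of curves, independent of the radius. *)
Let solution_exists (y : 'I_k -> R -> R) : exists u : R -> R,
  (exists2 r, 0 < r & forall i, curve r (y i)) ->
  exists2 r, 0 < r & solution r y u.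
Proof.
have [[r r0 yr]|ny] := pselect (exists2 r, 0 < r & forall i, curve r (y i)).
  have [u [r' [/andP[r'0 _] uc uh uk]]] := fold_solve hF r0 yr.
  by exists u => _; exists r'.
by exists (fun=> 0).
Qed.

(** Cells in [Z] are set to 0, which is consistent because [Z] is closed under sources and [h]
    vanishes at zero state. The other cells are solved one after the other by increasing rank. *)
Lemma fold_network : exists (u : cell L -> R -> R) (r : R), 0 < r /\
  forall c, [/\ curve r (u c),
    forall t, `|t| < r -> h (arg (u c t) (fun i => u (src i c) t) `|t|) = 0,
    Z c -> forall t, u c t = 0 &
    ~~ Z c -> forall t, `|t| < r -> kappa * `|t| <= u c t].
Proof.
have /choice[sol solP] := solution_exists.
(* Recursion on fuel: the final [fun=> 0] is a default for exhausted fuel, never reached when the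
   fuel exceeds the rank. By [BE] the value then does not depend on the fuel. *)
pose B := fix B n c := if Z c then fun=> 0 else
  if n is n'.+1 then sol (fun i => B n' (src i c)) else fun=> 0.
have BZ n c : Z c -> B n c = fun=> 0 by case: n => [|n] /= ->.
have BE n m c : (rank c < n)%N -> (rank c < m)%N -> B n c = B m c.
  elim: n m c => // n IH [//|m] c cn cm /=; case: ifPn => // Zc.
  congr sol; apply/funext => i; have := rank_src i Zc => ic.
  by apply: IH; [exact: leq_trans ic cn|exact: leq_trans ic cm].
pose u c := B (rank c).+1 c.
have uE c : ~~ Z c -> u c = sol (fun i => u (src i c)).
  move=> Zc; rewrite {1}/u /= (negPf Zc); congr sol; apply/funext => i.
  by apply: BE => //; exact: rank_src.
exists u.
pose P c r := [/\ curve r (u c),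
    forall t, `|t| < r -> h (arg (u c t) (fun i => u (src i c) t) `|t|) = 0,
    Z c -> forall t, u c t = 0 &
    ~~ Z c -> forall t, `|t| < r -> kappa * `|t| <= u c t].
have Pw c r r' : r' <= r -> P c r -> P c r'.
  move=> rr [uc uh uZ uk]; split => //; first exact: curveW uc.
  - by move=> t tr; apply: uh; exact: lt_le_trans rr.
  - by move=> Zc t tr; apply: uk => //; exact: lt_le_trans rr.
suff [r r0 rP] : exists2 r, 0 < r & forall c, P c r by exists r.
apply: common_radius => // c.
elim: {c}(rank c).+1 {-2}c (leqnn (rank c).+1) => // n IH c cn.
have [Zc|Zc] := boolP (Z c).
  exists 1 => //; have u0 : u c = fun=> 0 by exact: BZ.
  rewrite /P u0; split => //; [exact: curve_cst0| |by rewrite Zc].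
  move=> t _; rewrite -[RHS](fold_zero hF `|t|); congr (h (arg _ _ _)).
  by apply/funext => i; rewrite /u BZ //; exact: Z_src.
have [|r r0 [uc uh uk]] := solP (fun i => u (src i c)).
  apply: (@common_radius R 'I_k (fun i r => curve r (u (src i c)))).
  - by move=> i r r' rr; exact: curveW.
  - move=> i; have [|r r0 [uc _ _ _]] := IH (src i c); last by exists r.
    exact: leq_trans (rank_src i Zc) cn.
by exists r => //; rewrite /P uE //; split => //; rewrite (negPf Zc).
Qed.

End FoldNetwork.

(** * Reduction to the normal form by signs *)

Section FoldExists.
Variables (R : realType) (k : nat).

(** The required strict inequalities hold at the origin and persist on a ball by continuity. *)
Lemma fold_form_exists (h : inputs R k -> R) :
  smooth h -> (forall t, h (arg 0 (fun=> 0) t) = 0) ->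
  partial (idx0 k) h 0 = 0 ->
  partial (idx0 k) (partial (idx0 k) h) 0 < 0 ->
  (forall i, 0 < partial (idx i) h 0) ->
  0 < partial (idxl k) (partial (idx0 k) h) 0 ->
  exists d kappa, fold_form h d kappa.
Proof.
move=> hs h0 h1 hxx hy hxt.
set A := partial (idx0 k) (partial (idx0 k) h) 0 in hxx.
set B := partial (idxl k) (partial (idx0 k) h) 0 in hxt.
(* Any positive [kappa] below [B / (- A)] makes [kappa * A + B] positive; half of that bound leaves
   [B / 2]. *)
pose kappa := B / (- A) / 2.
have A0 : 0 < - A by rewrite oppr_gt0.
have kappa0 : 0 < kappa by rewrite !divr_gt0.
have kAB : 0 < kappa * A + B.
  suff -> : kappa * A = - B / 2 by lra.
  by rewrite /kappa; field; rewrite lt_eqF.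
have C i j : continuous (partial i (partial j h)).
  by apply: smooth_continuous; do 2!apply: smooth_partial.
have : \forall X \near (0 : inputs R k), [/\
    partial (idx0 k) (partial (idx0 k) h) X < 0,
    forall i, 0 < partial (idx i) h X &
    0 < kappa * partial (idx0 k) (partial (idx0 k) h) X +
        partial (idxl k) (partial (idx0 k) h) X].
  near=> X; split; near: X.
  - by apply: (cvgr_lt A) => //; exact: C.
  - apply: filter_forall => i; apply: (cvgr_gt (partial (idx i) h 0)) => //.
    exact: smooth_continuous (smooth_partial _ hs) _.
  - apply: (cvgr_gt (kappa * A + B)) => //.
    by apply: cvgD; [apply: cvgM; [exact: cvg_cst|exact: C]|exact: C].
move=> /nbhs_ballP[d d0 dP]; exists d, kappa.
have {}dP x y t : in_box d x y t -> _ :=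
  fun '(And3 xd yd td) => dP _ (ball0_arg d0 xd yd td).
split; [exact: hs|exact: h0|exact: h1|exact: d0|exact: kappa0|..].
- by move=> x y t /dP[].
- by move=> x y t /dP[].
- by move=> x y t /dP[].
Unshelve. all: by end_near. Qed.

End FoldExists.

Section Rescale.
Variables (R : realType) (n : nat) (a : R) (e : 'rV[R]_n).

(** Used with signs, for the vector [arg tau (fun=> tau) e]: [tau] flips the state, hence [x] and
    all inputs alike, and [e] flips the parameter. *)
Definition rescale (f : 'rV[R]_n -> R) : 'rV[R]_n -> R :=
  fun X => a * f (X *m diag_mx e).

Lemma diag_continuous : continuous (fun X : 'rV[R]_n => X *m diag_mx e).
Proof.
move=> X; apply: (@cvg_rV R n _ (nbhs X) (nbhs_filter X)) => i.
rewrite (_ : (fun _ => _) = fun X : 'rV[R]_n => X ord0 i * e ord0 i).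
  rewrite mul_mx_diag mxE; apply: cvgM; last exact: cvg_cst.
  exact: coord_continuous.
by apply/funext => Y; rewrite mul_mx_diag mxE.
Qed.

Lemma differentiable_rescale (f : 'rV[R]_n -> R) X :
  (forall X, differentiable f X) -> differentiable (rescale f) X.
Proof.
move=> fd; apply: differentiableZ.
apply: (@differentiable_comp _ _ _ _ (mulmxr (diag_mx e)) f) => //.
exact/linear_differentiable/diag_continuous.
Qed.

Lemma partial_rescale (f : 'rV[R]_n -> R) i X :
  (forall X, differentiable f X) ->
  partial i (rescale f) X = a * e ord0 i * partial i f (X *m diag_mx e).
Proof.
move=> fd.
have ld : differentiable (mulmxr (diag_mx e)) X.
  exact/linear_differentiable/diag_continuous.
have cd : differentiable (f \o mulmxr (diag_mx e)) X.
  exact: differentiable_comp.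
rewrite /partial deriveE; last exact: differentiable_rescale.
rewrite (_ : rescale f = a \*: (f \o mulmxr (diag_mx e))) //.
rewrite diffZ // diff_comp // diff_lin; last exact: diag_continuous.
rewrite /= -[_ *: _]/(_ * _) -mulrA; congr (_ * _).
rewrite deriveE // -[_ * _]/(_ *: _) -linearZ; congr ('d _ _ _).
apply/rowP => j; rewrite mul_mx_diag !mxE eqxx /= mulrC.
by case: eqVneq => [->|]; rewrite ?mulr0.
Qed.

End Rescale.

(** Iterated partial derivatives of a rescaled function are rescaled partial derivatives, with only
    the front factor changing. *)
Lemma smooth_rescale (R : realType) n (a : R) (e : 'rV[R]_n) f :
  smooth f -> smooth (rescale a e f).
Proof.
move=> fs s; have [c cE] : exists c, foldr (@partial R n) (rescale a e f) s =
    rescale c e (foldr (@partial R n) f s).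
  elim: s => [|i s [c cE]] /=; first by exists a.
  exists (c * e ord0 i); apply/funext => X; rewrite cE partial_rescale; first by [].
  exact: (fs s).
by move=> X; rewrite cE; apply: differentiable_rescale; exact: fs.
Qed.

Lemma deriv_upto_scale (R : realType) n (A : set R) (e : R) (g : R -> R) :
  deriv_upto n A g ->
  deriv_upto n [set x | A (e * x)] (fun x => g (e * x)).
Proof.
elim: n g => // n IH g [g' [gd g'd]].
exists (fun x => g' (e * x) * e); split; last first.
  by apply: deriv_uptoM; [exact: IH|exact: deriv_upto_cst].
move=> x /= Ax; apply: (@is_derive1_comp R g ( *%R e)); first exact: gd.
have := is_deriveZ e (is_derive_id x 1).
by rewrite -[_ *: 1]/(_ * 1) mulr1.
Qed.

Definition half_line (R : realType) (e : R) : domain_kind :=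
  if e == 1 then right_sided else left_sided.

Section BranchOfFold.
Variables (R : realType) (k : nat) (f : inputs R k -> R) (a tau e d kappa : R).
Hypotheses (a_neq0 : a != 0) (tau_sign : tau = 1 \/ tau = -1)
  (e_sign : e = 1 \/ e = -1)
  (hF : fold_form (rescale a (arg tau (fun=> tau) e) f) d kappa).

Let ee : e * e = 1.
Proof. by case: e_sign => ->; rewrite ?mulrNN mulr1. Qed.

Lemma half_lineP (r l : R) : domain (half_line e) r l -> 0 <= e * l < r.
Proof.
rewrite /half_line; case: e_sign => ->; rewrite ?eqxx ?mul1r.
  by rewrite /= in_itv.
have -> : (-1 == 1 :> R) = false by rewrite lt_eqF // ltrN10 ltr01.
by rewrite /= in_itv /= mulN1r oppr_ge0 ltrNl andbC.
Qed.

Lemma half_line_D0 (r l : R) : (domain (half_line e) r `\ 0) l -> 0 < e * l < r.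
Proof.
move=> [/half_lineP/andP[l0 lr] /eqP ln0]; rewrite lr andbT lt_neqAle l0 andbT.
by rewrite eq_sym mulf_neq0 //; case: e_sign => ->; rewrite ?oppr_eq0 oner_eq0.
Qed.

Let argM x y t : arg x y t *m diag_mx (arg tau (fun=> tau) e) =
  arg (tau * x) (fun i => tau * y i) (e * t) :> inputs R k.
Proof.
apply/rowP; apply: inputs_ind => [|i|]; rewrite mul_mx_diag mxE.
- by rewrite !arg_idx0 mulrC.
- by rewrite !arg_idx mulrC.
- by rewrite !arg_idxl mulrC.
Qed.

(** The branch is [tau * u c (e * l)]. On the half line where [e * l >= 0] the absolute value in the
    equations for [u] is [e * l], and [e * e = 1] gives back the parameter [l]. *)
Lemma branch_of_fold (L : network k) (rank : cell L -> nat) (Z : pred (cell L)) :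
  (forall c i, Z c -> Z (src i c)) ->
  (forall c i, ~~ Z c -> (rank (src i c) < rank c)%N) ->
  exists b : branch f L,
    (forall c, Z c -> forall l, b l c = 0) /\
    (forall c, ~~ Z c -> forall l, bdom b l -> kappa * `|l| <= `|b l c|).
Proof.
move=> Z_src rank_src.
have [u [r [r0 uP]]] := fold_network hF Z_src rank_src.
have tau1 : `|tau| = 1 by case: tau_sign => ->; rewrite ?normrN normr1.
have e1 : `|e| = 1 by case: e_sign => ->; rewrite ?normrN normr1.
have domP l : domain (half_line e) r l -> `|e * l| < r /\ `|e * l| = e * l.
  by move=> /half_lineP/andP[l0 lr]; rewrite ger0_norm.
pose b l c := tau * u c (e * l).
have b0 c : b 0 c = 0 by rewrite /b mulr0; have [/curve0 -> _ _ _] := uP c; rewrite mulr0.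
have beq l : domain (half_line e) r l -> forall c, vfield f (b l) l c = 0.
  move=> /domP[lr lE] c; have [_ /(_ _ lr) + _ _] := uP c.
  rewrite /rescale argM lE mulrA ee mul1r => /eqP.
  by rewrite mulf_eq0 (negPf a_neq0) /= => /eqP.
have breg c : branch_regular (half_line e) r (b^~ c).
  have [[_ _ uc ud] _ _ _] := uP c.
  suff H : {within domain (half_line e) r, continuous (b^~ c)} /\
      smooth_on (domain (half_line e) r `\ 0) (b^~ c).
    by move: H; rewrite /half_line; case: ifP.
  split.
    apply/subspace_continuousP => l /domP[lr _].
    apply: cvg_within_filter; rewrite /b; apply: cvgM; first exact: cvg_cst.
    apply: (@cvg_comp _ _ _ ( *%R e) (u c) _ (nbhs (e * l))); last exact: uc.
    by apply: cvgM; [exact: cvg_cst|exact: cvg_id].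
  pose A : set R := [set x | `]0, r[%classic (e * x)].
  have Ao : open A.
    apply: (@open_comp _ _ ( *%R e)); last exact: itv_open.
    by move=> x _; apply: cvgM; [exact: cvg_cst|exact: cvg_id].
  have bs : smooth_on A (b^~ c).
    apply: deriv_upto_smooth_on => // n.
    by apply: deriv_uptoM; [exact: deriv_upto_cst|exact: deriv_upto_scale].
  move=> n l /half_line_D0 lr; apply: bs.
  by rewrite /A /= in_itv.
exists (Branch r0 b0 beq breg); split=> [c Zc l|c Zc l /domP[lr _]] /=.
  by rewrite /b; have [_ _ -> //] := uP c; rewrite mulr0.
have [_ _ _ /(_ Zc _ lr) H] := uP c.
rewrite /b normrM tau1 mul1r; apply: le_trans (ler_norm _).
by move: H; rewrite normrM e1 mul1r.
Qed.

End BranchOfFold.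

Lemma exists_sign (R : realType) (x : R) : x != 0 ->
  exists2 e : R, e = 1 \/ e = -1 & 0 < e * x.
Proof.
case: ltgtP => // x0 _; [exists (-1)|exists 1].
- by right.
- by rewrite mulN1r oppr_gt0.
- by left.
- by rewrite mul1r.
Qed.

Lemma sign_mul (R : realType) (x y : R) :
  x = 1 \/ x = -1 -> y = 1 \/ y = -1 -> x * y = 1 \/ x * y = -1.
Proof.
by case=> ->; case=> ->; rewrite ?mulrNN ?mulr1 ?mul1r; [left|right|right|left].
Qed.

Section NormalForm.
Variables (R : realType) (k : nat).

(** The sign [a] makes the second derivative in [x] negative, whatever [tau] is, since
    [tau * tau = 1]. With [s] the common sign of the [f_i], [tau = a * s] makes the input
    derivatives positive, and [e' = a * tau * e] then fixes the sign of the mixed derivative. *)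
Lemma exists_fold_form (f : inputs R k -> R) :
  classV0 f ->
  partial (idx0 k) (partial (idx0 k) f) 0 != 0 ->
  partial (idxl k) (partial (idx0 k) f) 0 != 0 ->
  (forall i : 'I_k, 0 < partial (idx i) f 0) \/
  (forall i : 'I_k, partial (idx i) f 0 < 0) ->
  exists a tau e d kappa : R, [/\ a != 0, tau = 1 \/ tau = -1, e = 1 \/ e = -1 &
    fold_form (rescale a (arg tau (fun=> tau) e) f) d kappa].
Proof.
move=> [[fs fz] f0] fxx fxt fy.
have [a' a'1 a'P] := exists_sign fxx; pose a := - a'.
have a1 : a = 1 \/ a = -1 by rewrite /a; case: a'1 => ->; rewrite ?opprK; [right|left].
have [s s1 sP] : exists2 s : R, s = 1 \/ s = -1 &
    forall i : 'I_k, 0 < s * partial (idx i) f 0.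
  case: fy => fy; [exists 1; first by left|exists (-1); first by right].
  - by move=> i; rewrite mul1r.
  - by move=> i; rewrite mulN1r oppr_gt0.
have [e e1 eP] := exists_sign fxt.
pose tau := a * s; have sq (x : R) : x = 1 \/ x = -1 -> x * x = 1.
  by case=> ->; rewrite ?mulrNN mulr1.
have tau1 : tau = 1 \/ tau = -1.
  exact: sign_mul.
pose e' := a * tau * e.
have e'1 : e' = 1 \/ e' = -1.
  by do 2!apply: sign_mul => //.
have a0 : a != 0 by case: a1 => ->; rewrite ?oppr_eq0 oner_eq0.
have fd (g : inputs R k -> R) : smooth g -> forall X, differentiable g X.
  by move=> gs X; exact: smooth_differentiable.
pose E := arg tau (fun _ : 'I_k => tau) e'.
have p1 i : partial i (rescale a E f) = rescale (a * E ord0 i) E (partial i f).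
  by apply/funext => X; rewrite partial_rescale //; exact: fd.
have p2 i j : partial j (partial i (rescale a E f)) 0 =
    a * E ord0 i * E ord0 j * partial j (partial i f) 0.
  by rewrite p1 partial_rescale ?mul0mx //; apply/fd/smooth_partial.
have [d [kappa hF]] : exists d kappa, fold_form (rescale a E f) d kappa.
  apply: fold_form_exists.
  - exact: smooth_rescale.
  - move=> t; rewrite /rescale.
    suff -> : arg 0 (fun=> 0) t *m diag_mx E = arg 0 (fun=> 0) (e' * t).
      by rewrite arg_zero fz mulr0.
    apply/rowP; apply: inputs_ind => [|i|]; rewrite mul_mx_diag mxE.
    + by rewrite !arg_idx0 mul0r.
    + by rewrite !arg_idx mul0r.
    + by rewrite !arg_idxl mulrC.
  - by rewrite p1 /rescale mul0mx f0 mulr0.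
  - rewrite p2 arg_idx0 -(mulrA a) (sq _ tau1) mulr1 /a mulNr oppr_lt0.
    exact: a'P.
  - move=> i; rewrite p1 /rescale mul0mx arg_idx /tau mulrA (sq _ a1) mul1r.
    exact: sP.
  - rewrite p2 arg_idx0 arg_idxl /e' mulrA (_ : _ * _ * e = e) //.
    by rewrite mulrACA; rewrite (sq _ a1) (sq _ tau1) !mul1r.
by exists a, tau, e', d, kappa; split.
Qed.

End NormalForm.

(** * Genericity *)

Section SmoothQuadratic.
Variables (R : realType) (n : nat).
Implicit Types (f g : 'rV[R]_n -> R) (A B : 'cV[R]_n).

Lemma smooth_step f : (forall x, differentiable f x) ->
  (forall i, smooth (partial i f)) -> smooth f.
Proof.
move=> fd fs s x; case/lastP: s => [|s i]; first exact: fd.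
by rewrite foldr_rcons; exact: fs.
Qed.

Lemma smooth_cst (c : R) : smooth (fun _ : 'rV[R]_n => c).
Proof.
move=> s; have [c' ->] : exists c', foldr (@partial R n) (fun=> c) s = fun=> c'.
  elim: s => [|i s [c' E]] /=; first by exists c.
  by exists 0; apply/funext => X; rewrite E /partial derive_cst.
by move=> x; exact: differentiable_cst.
Qed.

Lemma partialD f g i : (forall x, differentiable f x) ->
  (forall x, differentiable g x) ->
  partial i (fun X => f X + g X) = fun X => partial i f X + partial i g X.
Proof.
move=> fd gd; apply/funext => X.
by rewrite /partial -deriveD //; exact: diff_derivable.
Qed.

Lemma partialZ f (c : R) i : (forall x, differentiable f x) ->
  partial i (fun X => c * f X) = fun X => c * partial i f X.
Proof.
move=> fd; apply/funext => X.
by rewrite /partial -[RHS]/(c *: _) -deriveZ //; exact: diff_derivable.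
Qed.

Lemma smoothD f g : smooth f -> smooth g -> smooth (fun X => f X + g X).
Proof.
move=> fs gs s; have -> : foldr (@partial R n) (fun X => f X + g X) s =
    fun X => foldr (@partial R n) f s X + foldr (@partial R n) g s X.
  by elim: s => //= i s ->; rewrite partialD.
by move=> x; apply: differentiableD; [exact: (fs s)|exact: (gs s)].
Qed.

Lemma smoothZ f (c : R) : smooth f -> smooth (fun X => c * f X).
Proof.
move=> fs s; have -> : foldr (@partial R n) (fun X => c * f X) s =
    fun X => c * foldr (@partial R n) f s X.
  by elim: s => //= i s ->; rewrite partialZ.
by move=> x; apply: differentiableZ; exact: (fs s).
Qed.

(** The linear form with coefficients [A]; products of two such forms are the quadratic
    perturbations of the density argument. *)
Definition form A (X : 'rV[R]_n) : R := (X *m A) ord0 ord0.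

Let formE A : form A =
  \sum_j (fun X : 'rV[R]_n => A j ord0 *: X ord0 j).
Proof.
apply/funext => Y; rewrite /form mxE fct_sumE; apply: eq_bigr => j _.
by rewrite mulrC.
Qed.

Lemma differentiable_form A X : differentiable (form A) X.
Proof.
by rewrite formE; apply: differentiable_sum => j;
  apply/differentiableZ/differentiable_coord.
Qed.

Lemma partial_form A i :
  partial i (form A) = fun=> A i ord0.
Proof.
apply/funext => X; rewrite /partial formE.
have cd j : is_derive X (delta_mx ord0 i : 'rV[R]_n)
    (fun Y : 'rV[R]_n => Y ord0 j) (i == j)%:R.
  apply: DeriveDef; first exact/diff_derivable/differentiable_coord.
  have := derive_mx (@derivable_id R 'rV[R]_n X (delta_mx ord0 i)).
  by rewrite derive_id => /rowP/(_ j); rewrite !mxE eqxx /= eq_sym.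
have sd := is_derive_sum (fun j => is_deriveZ (A j ord0) (cd j)).
rewrite (@derive_val _ _ _ _ _ _ _ sd) (bigD1 i) //= eqxx big1.
  by rewrite addr0 -[_ *: _]/(_ * _) mulr1.
by move=> j ji; rewrite eq_sym (negPf ji) scaler0.
Qed.

Lemma smooth_form A : smooth (form A).
Proof.
apply: smooth_step => [x|i]; first exact: differentiable_form.
by rewrite partial_form; exact: smooth_cst.
Qed.

Lemma partial_formM A B i :
  partial i (fun X => form A X * form B X) =
  fun X => A i ord0 * form B X + B i ord0 * form A X.
Proof.
apply/funext => X; rewrite /partial.
rewrite (@deriveM _ _ (form A) (form B));
  try exact/diff_derivable/differentiable_form.
rewrite -!/(partial i _ _) !partial_form -![_ *: _]/(_ * _).
by rewrite addrC mulrC [X in _ + X]mulrC.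
Qed.

Lemma partial2_formM A B i j :
  partial j (partial i (fun X => form A X * form B X)) =
  fun=> A i ord0 * B j ord0 + B i ord0 * A j ord0.
Proof.
rewrite partial_formM partialD; first last.
- by move=> X; apply/differentiableZ/differentiable_form.
- by move=> X; apply/differentiableZ/differentiable_form.
by rewrite !partialZ ?partial_form //; exact: differentiable_form.
Qed.

Lemma smooth_formM A B :
  smooth (fun X => form A X * form B X).
Proof.
apply: smooth_step => [x|i].
  by apply: differentiableM; exact: differentiable_form.
by rewrite partial_formM; apply: smoothD; apply: smoothZ; exact: smooth_form.
Qed.

Lemma jet2D_Z f g (c : R) : smooth f -> smooth g ->
  jet2 (fun X => f X + c * g X) = jet2 f + c *: jet2 g.
Proof.
move=> fs gs.
have fd h : smooth h -> forall X, differentiable h X.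
  by move=> hs X; exact: smooth_differentiable.
have cs := smoothZ c gs.
have E i : partial i (fun X => f X + c * g X) =
    fun X => partial i f X + c * partial i g X.
  by rewrite partialD ?partialZ //; exact: fd.
rewrite /jet2; congr pair.
  by apply/rowP => i; rewrite !mxE E.
apply/matrixP => i j; rewrite !mxE E partialD ?partialZ //.
- exact/fd/smooth_partial.
- exact/fd/smooth_partial.
- exact/fd/smoothZ/smooth_partial.
Qed.

End SmoothQuadratic.

Lemma near_affine_neq0 (R : realType) (x c : R) : c != 0 ->
  \forall s \near (0 : R)^', x + s * c != 0.
Proof.
move=> c0; have [->|x0] := eqVneq x 0.
  near=> s; rewrite add0r mulf_neq0 //; near: s; exact: nbhs_dnbhs_neq.
apply: nbhs_dnbhs; have H : x + s * c @[s --> (0 : R)] --> x.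
  rewrite -[X in _ --> X]addr0 -[X in _ + X](mul0r c); apply: cvgD.
    exact: cvg_cst.
  by apply: cvgM; [exact: cvg_id|exact: cvg_cst].
exact: (cvgr_neq0 _ H).
Unshelve. all: by end_near. Qed.

(** Nonvanishing of two jet entries is an open condition. For density, a small multiple of one
    quadratic polynomial makes both entries nonzero without leaving the class. *)
Lemma generic_second_order (R : realType) k :
  generically (@classV0 R k) (fun f =>
    partial (idx0 k) (partial (idx0 k) f) 0 != 0 /\
    partial (idxl k) (partial (idx0 k) f) 0 != 0).
Proof.
set n := (1 + (k + 1))%N; set o := idx0 k; set l := idxl k.
pose U := [set J : 'rV[R]_n * 'M[R]_n | J.2 o o != 0 /\ J.2 l o != 0].
exists (U `&` (@jet2 R n) @` (@classV0 R k)); split.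
- exists U => //; apply: openI.
  + apply: (@open_comp _ _ (fun J : 'rV[R]_n * 'M[R]_n => J.2 o o)
      [set x | x != 0]); last exact: open_neq.
    move=> J _; apply: (@cvg_comp _ _ _ snd (fun M : 'M[R]_n => M o o) _ (nbhs J.2)).
      exact: cvg_snd.
    exact: coord_continuous.
  + apply: (@open_comp _ _ (fun J : 'rV[R]_n * 'M[R]_n => J.2 l o)
      [set x | x != 0]); last exact: open_neq.
    move=> J _; apply: (@cvg_comp _ _ _ snd (fun M : 'M[R]_n => M l o) _ (nbhs J.2)).
      exact: cvg_snd.
    exact: coord_continuous.
- move=> _ [f fF <-] B nB.
  have [[fs fz] f0] := fF.
  (* [q] is [x_0 * (x_0 + lambda)]: it vanishes for [x_0 = 0], has zero gradient at the origin, and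
     its two relevant second derivatives are 2 and 1. *)
  pose A : 'cV[R]_n := delta_mx o ord0.
  pose A' : 'cV[R]_n := delta_mx o ord0 + delta_mx l ord0.
  pose q X := form A X * form A' X.
  have qs : smooth q by exact: smooth_formM.
  have ol : (o == l) = false.
    by rewrite /o /l /idx0 /idxl; apply/negbTE; rewrite eq_lrshift.
  have J00 : (jet2 q).2 o o != 0.
    rewrite mxE partial2_formM !mxE !eqxx ol /= addr0 mulr1.
    by rewrite -[_ + _]/(2%:R) pnatr_eq0.
  have Jl0 : (jet2 q).2 l o != 0.
    rewrite mxE partial2_formM !mxE !eqxx ![l == o]eq_sym ol /= add0r mulr1.
    by rewrite mulr0 addr0 oner_neq0.
  have Fq c : classV0 (fun X => f X + c * q X).
    split; first split; first by apply: smoothD => //; exact: smoothZ.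
      move=> t; rewrite fz add0r /q (_ : form A _ = 0) ?mul0r ?mulr0 //.
      by rewrite /form /A -colE mxE -arg_zero arg_idx0.
    rewrite partialD; [|by move=> X; exact: smooth_differentiable|]; last first.
      by move=> X; apply/smooth_differentiable/smoothZ.
    rewrite partialZ; last by move=> X; exact: smooth_differentiable.
    have z : (0 : 'M[R]_1) ord0 ord0 = 0 by rewrite mxE.
    by rewrite f0 /q partial_formM /form !mul0mx z !mulr0 !addr0 mulr0 addr0.
  have Jc : jet2 f + c *: jet2 q @[c --> (0 : R)] --> jet2 f.
    rewrite -[X in _ --> X]addr0 -(scale0r (jet2 q)); apply: cvgD.
      exact: cvg_cst.
    exact: scalel_continuous.
  have : \forall c \near (0 : R)^', [/\ B (jet2 f + c *: jet2 q),
      (jet2 f).2 o o + c * (jet2 q).2 o o != 0 &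
      (jet2 f).2 l o + c * (jet2 q).2 l o != 0].
    near=> c; split; near: c; last 2 first.
    + exact: near_affine_neq0.
    + exact: near_affine_neq0.
    apply: nbhs_dnbhs; exact: Jc.
  move=> /filter_ex[c [Bc c1 c2]].
  exists (jet2 f + c *: jet2 q); split => //; split.
    have E (J J' : 'rV[R]_n * 'M[R]_n) i j :
      (J + c *: J').2 i j = J.2 i j + c * J'.2 i j by rewrite !mxE.
    by split; rewrite E.
  by exists (fun X => f X + c * q X) => //; exact: jet2D_Z.
- by move=> f _ [[H1 H2] _]; split; [move: H1|move: H2]; rewrite mxE.
Unshelve. all: by end_near. Qed.

(** * Germs of branches *)

Lemma domainE (R : realType) (s : domain_kind) (r l : R) : domain s r l <->
  `|l| < r /\ match s with
    left_sided => l <= 0 | two_sided => True | right_sided => 0 <= l end.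
Proof.
case: s; rewrite /= in_itv /=.
- split=> [/andP[rl l0]|[+ l0]]; first by rewrite ler0_norm // ltrNl.
  by rewrite ler0_norm // ltrNl l0 => ->.
- by rewrite ltr_norml; split=> [|[]].
- split=> [/andP[l0 rl]|[+ l0]]; first by rewrite ger0_norm.
  by rewrite ger0_norm // l0 => ->.
Qed.

Lemma domain_point (R : realType) (s : domain_kind) (r rho : R) :
  0 < r -> 0 < rho -> exists l, [/\ domain s r l, l != 0 & `|l| < rho].
Proof.
move=> r0 rho0; set t := Num.min r rho / 2.
have t0 : 0 < t by rewrite divr_gt0 // lt_min r0.
have [tr trho] : t < r /\ t < rho.
  have : t < Num.min r rho by rewrite /t gtr_pMr ?lt_min ?r0 // invf_lt1 ?ltr1n.
  by rewrite lt_min => /andP.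
have [tN tA] : t != 0 /\ `|t| = t by rewrite gt_eqF // gtr0_norm.
exists (if s is left_sided then - t else t); split; first apply/domainE.
- by case: s; rewrite ?normrN tA ?oppr_le0; split=> //; exact: ltW.
- by case: s; rewrite ?oppr_eq0.
- by case: s; rewrite ?normrN tA.
Qed.

Section Germs.
Variables (R : realType) (k : nat) (f : inputs R k -> R) (L : network k).
Variables c d : cell L.

(* Survives germ equivalence even though a chain of germs may change sides:
   a change of side goes through a two-sided branch, which is differentiable
   at 0. *)
Definition separates (b : branch f L) : Prop :=
  exists K rho, [/\ 0 < K, 0 < rho & forall l, bdom b l -> `|l| < rho ->
    K * `|l| <= `|b l d - b l c|].

Lemma separates_neq (b : branch f L) (rho : R) : 0 < rho -> separates b ->
  exists l, [/\ bdom b l, `|l| < rho & b l c <> b l d].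
Proof.
move=> rho0 [K [rho' [K0 rho'0 H]]].
have m0 : 0 < Num.min rho rho' by rewrite lt_min rho0.
have [l [bl l0]] := domain_point (bkind b) (bradius_gt0 b) m0.
rewrite lt_min => /andP[lr lr']; exists l; split => // E.
have := H _ bl lr'; rewrite E subrr normr0 leNgt => /negP; apply.
by rewrite mulr_gt0 ?normr_gt0.
Qed.

(** The bound passes to the common domain. If that covers the domain of [b2] near 0, nothing more is
    required; otherwise [b2] is two-sided, and the derivative at 0 carries the bound to the other
    side with a smaller constant. *)
Lemma germ_related_separates (b1 b2 : branch f L) :
  germ_related b1 b2 -> separates b1 -> separates b2.
Proof.
move=> [U [Uo U0 UD Ueq]] [K [rho [K0 rho0 H]]].
have [u u0 uU] : exists2 u : R, 0 < u & forall l, `|l| < u -> U l.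
  have /nbhs_ballP[u u0 uU] : nbhs (0 : R) U by exact: open_nbhs_nbhs.
  by exists u => // l lu; apply: uU; rewrite -ball_normE /= sub0r normrN.
have r1 := bradius_gt0 b1.
pose rho' := Num.min rho (Num.min u (bradius b1)).
have rho'0 : 0 < rho' by rewrite !lt_min rho0 u0.
have H' l : bdom b1 l -> bdom b2 l -> `|l| < rho' ->
    K * `|l| <= `|b2 l d - b2 l c|.
  move=> l1 l2; rewrite !lt_min => /and3P[lr lu _].
  have Ul : (U `&` bdom b1 `&` bdom b2) l by split=> //; split=> //; exact: uU.
  by rewrite -!(Ueq _ Ul); exact: H.
(* Opposite one-sided domains meet only in 0, which the definition of related germs excludes. *)
have [side|two] : (forall l, bdom b2 l -> `|l| < rho' -> bdom b1 l) \/
    bkind b2 = two_sided.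
  case E2 : (bkind b2); [left|by right|left];
    move=> l /domainE[lr2]; rewrite E2 => l0; rewrite !lt_min => /and3P[_ _ lr1];
    apply/domainE; split => //; case E1 : (bkind b1) => //;
    exfalso; apply: UD; apply/seteqP; split=> x.
  - move=> [[_ /domainE[_]]]; rewrite E1 => x0 /domainE[_]; rewrite E2 => x0'.
    by apply/eqP; rewrite eq_le x0 x0'.
  - move=> ->; split; first split => //; apply/domainE; rewrite normr0 ?E1 ?E2;
      by split => //; exact: bradius_gt0.
  - move=> [[_ /domainE[_]]]; rewrite E1 => x0 /domainE[_]; rewrite E2 => x0'.
    by apply/eqP; rewrite eq_le x0 x0'.
  - move=> ->; split; first split => //; apply/domainE; rewrite normr0 ?E1 ?E2;
      by split => //; exact: bradius_gt0.
- exists K, rho'; split => // l l2 lr; exact: H' (side _ l2 lr) l2 lr.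
pose g l : R := b2 l d - b2 l c.
have gD : derivable g 0 1.
  have D x : derivable (b2^~ x) 0 1.
    have := bfun_regular b2 x; rewrite two /branch_regular => /(_ 0%N 0); apply.
    by apply/domainE; rewrite normr0; split => //; exact: bradius_gt0.
  exact: derivableB.
have g0 : g 0 = 0 by rewrite /g !bfun0 subrr.
(* Precision [K / 4] is spent twice: the derivative at 0 is at least [3 / 4 * K] in absolute value,
   and the quotients on both sides are then at least [K / 2]. *)
have [eta eta0 etaP] : exists2 eta : R, 0 < eta & forall l, l != 0 ->
    `|l| < eta -> `|'D_1 g 0 - l^-1 * g l| < K / 4.
  have K4 : 0 < K / 4 by rewrite divr_gt0.
  have /cvgrPdist_lt/(_ _ K4)/nbhs_ballP[eta eta0 etaP] := gD.
  exists eta => // l ln0 leta.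
  have bl : ball (0 : R) eta l by rewrite -ball_normE /= sub0r normrN.
  have E : (g \o shift 0) l%:A - g 0 = g l.
    by rewrite /= addr0 g0 subr0 [l%:A]mulr1.
  by have := etaP l bl ln0; rewrite E.
have quot l : l != 0 -> `|l^-1 * g l| * `|l| = `|g l|.
  by move=> l0; rewrite -normrM mulrAC mulVf // mul1r.
have DK : 3 / 4 * K <= `|'D_1 g 0|.
  have m0 : 0 < Num.min rho' eta by rewrite lt_min rho'0.
  have m1 : 0 < Num.min (bradius b1) (bradius b2).
    by rewrite lt_min r1 bradius_gt0.
  have [l [l1 ln0]] := domain_point (bkind b1) m1 m0.
  rewrite lt_min => /andP[lr leta]; move/domainE: l1 => [+ l1].
  rewrite lt_min => /andP[lr1 lr2].
  have Kl : K * `|l| <= `|g l|.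
    by apply: H' => //; apply/domainE; [|rewrite two].
  have := etaP _ ln0 leta.
  have : K <= `|l^-1 * g l|.
    have lp : 0 < `|l| by rewrite normr_gt0.
    by rewrite -(ler_pM2r lp) quot.
  have := ler_normD ('D_1 g 0) (l^-1 * g l - 'D_1 g 0).
  rewrite addrC subrK distrC.
  by move=> *; lra.
exists (K / 2), eta; split => //; first by rewrite divr_gt0.
move=> l _ leta; have [->|ln0] := eqVneq l 0; first by rewrite normr0 mulr0.
rewrite -/(g l) -quot //; apply: ler_wpM2r => //.
have := etaP _ ln0 leta.
have := ler_normD (l^-1 * g l) ('D_1 g 0 - l^-1 * g l).
rewrite addrC subrK.
by move=> *; lra.
Qed.

Lemma germ_equiv_separates (b1 b2 : branch f L) :
  germ_equiv b1 b2 -> separates b1 -> separates b2.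
Proof.
elim=> [b b'|b b' b'' _ IH1 _ IH2 /IH1/IH2 //]; exact: germ_related_separates.
Qed.

Lemma separates_bifurcation (b : branch f L) :
  separates b -> bifurcation_branch b.
Proof.
move=> bs [b0 b00 /germ_equiv_separates/(_ bs) s0].
have [l [l0 _]] := separates_neq ltr01 s0.
by apply; rewrite !b00.
Qed.

Lemma separates_not_lifted (N : network k) (b : branch f L) :
  (forall e : equiv_rel (cell L), balanced e -> net_eq N (quotient_net e) ->
    e c d) ->
  separates b -> ~ lifted_from N b.
Proof.
move=> ecd bs [e [eb Ne [b' /germ_equiv_separates/(_ bs) s' /nbhs_ballP[r r0 H]]]].
have [l [bl lr]] := separates_neq r0 s'; apply; apply: H => //.
  by rewrite -ball_normE /= sub0r normrN.
exact: ecd.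
Qed.

End Germs.

(** * Layers and quotients *)

Section Layers.
Variable k : nat.

(** The partition becomes a layer function. The convention [0.-1 = 0] fits the loops in layer 0, so
    one formula describes the sources in all layers. *)
Lemma feed_forward_layer (N : network k) m (C : nat -> {set cell N}) :
  feed_forward m C -> exists ly : cell N -> nat, [/\
    forall c, (ly c <= m)%N,
    forall c j, (j <= m)%N -> (c \in C j) = (ly c == j),
    forall i c, ly (src i c) = (ly c).-1,
    forall i c, ly c = 0%N -> src i c = c &
    forall j, (j <= m)%N -> exists c, ly c = j].
Proof.
move=> [[Cn0 Cu] C0 Cs _ _].
have /choice[ly lyP] := Cu.
have lym c : (ly c <= m)%N by have [[]] := lyP c.
have lyC c j : (j <= m)%N -> (c \in C j) = (ly c == j).
  move=> jm; have [[_ cC] cu] := lyP c.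
  by apply/idP/eqP => [cj|<- //]; exact: cu.
have ly0 i c : ly c = 0%N -> src i c = c.
  by move=> l0; apply: C0; rewrite lyC // l0.
exists ly; split => // [i c|j jm].
- case E : (ly c) => [|l]; first by rewrite ly0.
  apply/eqP; rewrite -lyC; last by rewrite /= -ltnS ltnW // ltnS -E.
  rewrite -[l]/(l.+1.-1); apply: Cs; first by rewrite /= -E.
  by rewrite lyC ?E // -E.
- by have /finset.set0Pn[c] := Cn0 j jm; rewrite lyC // => /eqP; exists c.
Qed.

(** Presentations of [N] as a quotient become surjective homomorphisms with the coloring as kernel:
    the projection followed by the inverse of the given isomorphism. *)
Lemma quotient_hom (L N : network k) (e : equiv_rel (cell L)) :
  balanced e -> net_eq N (quotient_net e) ->
  exists p : cell L -> cell N, [/\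
    forall i c, p (src i c) = src i (p c),
    forall v, exists c, p c = v &
    forall c d, e c d = (p c == p d)].
Proof.
move=> eb [phi [[psi phiK psiK] phi_src]].
have E (c d : cell L) : e c d = (\pi_({eq_quot e}) c == \pi_({eq_quot e}) d).
  by rewrite eqmodE.
exists (fun c => psi (\pi_({eq_quot e}) c)); split.
- move=> i c; apply: (can_inj phiK); rewrite phi_src !psiK /=.
  by apply/eqP; rewrite -E; apply: eb; rewrite E reprK.
- by move=> v; exists (repr (phi v)); rewrite reprK phiK.
- by move=> c d; rewrite E (inj_eq (can_inj psiK)).
Qed.

(** A path from [c] to [r] exhibits [c] as an iterated source of [r]. *)
Lemma backward_ind (L : network k) (r : cell L) (S : cell L -> Prop) :
  (forall c, c != r -> connect (@edge k L) c r) ->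
  S r -> (forall i c, S c -> S (src i c)) -> forall c, S c.
Proof.
move=> rP Sr S_src c.
have : connect (@edge k L) c r.
  by have [->|] := eqVneq c r; [exact: connect0|exact: rP].
move=> /connectP[q]; elim: q c => [|x q IH] c /=; first by move=> _ <-.
by move=> /andP[/existsP[i /eqP <-] xq] /(IH _ xq); exact: S_src.
Qed.

Section Homs.
Variables (L N : network k) (m : nat) (i0 : 'I_k).
Variables (lyN : cell N -> nat) (ly : cell L -> nat) (r : cell L).
Hypotheses (m_gt0 : (0 < m)%N)
  (ly_max : forall c, (ly c <= m)%N)
  (lyN_src : forall i v, lyN (src i v) = (lyN v).-1)
  (ly_src : forall i c, ly (src i c) = (ly c).-1)
  (ly0 : forall i c, ly c = 0%N -> src i c = c)
  (lyN_onto : exists v, lyN v = m)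
  (ly_onto : exists c, ly c = m)
  (rP : forall c, c != r -> connect (@edge k L) c r).

(** Passing to sources never raises the layer, and every cell is an iterated source of [r]. *)
Let ly_r : ly r = m.
Proof.
have [c cm] := ly_onto; apply/eqP; rewrite eqn_leq ly_max -cm /=.
apply: (backward_ind (S := fun c => (ly c <= ly r)%N) rP) => // i c' c'r.
by rewrite ly_src (leq_trans (leq_pred _)).
Qed.

(** A cell other than [r] is the source of some cell, hence lies strictly below the top layer. *)
Let ly_eq_m c : ly c = m -> c = r.
Proof.
have : c = r \/ (ly c < m)%N.
  apply: (backward_ind (S := fun c => c = r \/ (ly c < m)%N) rP).
    by left.
  by move=> i c' _; right; rewrite ly_src; case: (ly c') (ly_max c').
by case=> [//|+ E]; rewrite E ltnn.
Qed.

Section Hom.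
Variable p : cell L -> cell N.
Hypotheses (p_src : forall i c, p (src i c) = src i (p c))
  (p_onto : forall v, exists c, p c = v).

(** Induction on the layer in [L]. A cell of layer 0 is fixed by [src i0], so its image is fixed too
    and has layer 0. *)
Let lyN_le c : (lyN (p c) <= ly c)%N.
Proof.
suff H l c' : ly c' = l -> (lyN (p c') <= l)%N by exact: H.
elim: l c' => [|l IH] {}c lc.
  have := lyN_src i0 (p c); rewrite -p_src ly0 //.
  by case: (lyN (p c)) => // n /eqP; rewrite eqn_leq ltnn.
have : (lyN (p (src i0 c)) <= l)%N by apply: IH; rewrite ly_src lc.
by rewrite p_src lyN_src; case: (lyN (p c)).
Qed.

Lemma hom_top v : lyN v = m -> v = p r.
Proof.
have [c <-] := p_onto v => vm; congr p; apply: ly_eq_m; apply/eqP.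
by rewrite eqn_leq ly_max -vm lyN_le.
Qed.

Lemma hom_layer c : lyN (p c) = ly c.
Proof.
apply: (backward_ind (S := fun c => lyN (p c) = ly c) rP).
  by have [v vm] := lyN_onto; rewrite -(hom_top vm) vm ly_r.
by move=> i c' E; rewrite p_src lyN_src ly_src E.
Qed.

End Hom.

(** Both maps send [r] to the same top cell of [N], and agreement at a cell passes to its
    sources. *)
Lemma hom_unique (p p' : cell L -> cell N) :
  (forall i c, p (src i c) = src i (p c)) -> (forall v, exists c, p c = v) ->
  (forall i c, p' (src i c) = src i (p' c)) -> (forall v, exists c, p' c = v) ->
  forall c, p c = p' c.
Proof.
move=> ps po ps' po'; apply: (backward_ind (S := fun c => p c = p' c) rP).
  have [v vm] := lyN_onto.
  by rewrite -(hom_top ps po vm) -(hom_top ps' po' vm).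
by move=> i c E; rewrite ps ps' E.
Qed.

End Homs.

(** The projection maps layer [j] of [L] onto layer [j] of [N]; if it were injective there, the
    cardinals would agree. By uniqueness of the projection, the merged pair is the same for every
    admissible coloring. *)
Lemma lift_merges (N L : network k) (m n : nat) (C : nat -> {set cell N})
    (C' : nat -> {set cell L}) (j : nat) :
  feed_forward m C -> feed_forward n C' -> is_lift L N ->
  backward_connected L -> lift_inside_layer m n C C' j -> (0 < j <= m)%N ->
  exists c d, [/\ c <> d, c \in C' j, d \in C' j &
    forall e : equiv_rel (cell L), balanced e -> net_eq N (quotient_net e) ->
      e c d].
Proof.
move=> NF LF [e0 [eb0 eN0]] [r rP] [mn Cj _] /andP[j0 jm]; subst n.
have m0 : (0 < m)%N by exact: leq_trans jm.
have [lyN [lyNm lyNC lyNs lyN0 lyNo]] := feed_forward_layer NF.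
have [ly [lym lyC lys ly0 lyo]] := feed_forward_layer LF.
have [i0 _] : exists i : 'I_k, True.
  have [c c0] := lyNo 0%N isT; have [_ _ _ H _] := NF.
  have cC : c \in C 0%N by rewrite lyNC // c0.
  by have [c' _ [i _]] := H 0%N c m0 cC; exists i.
have [p [ps po pe]] := quotient_hom eb0 eN0.
have pl := hom_layer i0 m0 lym lyNs lys ly0 (lyNo _ (leqnn m)) (lyo _ (leqnn m)) rP ps po.
have [[c [d [cj dj cd pcd]]]|inj] := pselect (exists c d,
    [/\ c \in C' j, d \in C' j, c <> d & p c = p d]).
  exists c, d; split => // e eb eN; have [p' [ps' po' ->]] := quotient_hom eb eN.
  have pp' := hom_unique i0 m0 lym lyNs lys ly0 (lyNo _ (leqnn m)) rP
    ps po ps' po'.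
  by rewrite -!pp' pcd.
exfalso; apply: Cj; rewrite -(@card_in_imset _ _ p).
  congr (#|pred_of_set _|); apply/setP => v; rewrite lyNC //.
  apply/imsetP/eqP => [[c + ->]|vj]; first by rewrite lyC // pl => /eqP.
  by have [c cv] := po v; exists c; rewrite // lyC // -pl cv vj.
move=> c d cj dj pcd; apply/eqP/negP => cd; apply: inj; exists c, d; split => //.
by apply/eqP/negP.
Qed.

End Layers.

(** * The branch separating two merged cells *)

Theorem proposition6p5 (R : realType) (k m : nat) (N : network k)
    (C : nat -> {set cell N}) (hN : feed_forward m C) :
  generically (@classV0 R k) (fun f =>
    forall (L : network k) (n : nat) (C' : nat -> {set cell L}) (j : nat),
      feed_forward n C' ->
      is_lift L N ->
      backward_connected L ->
      lift_inside_layer m n C C' j ->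
      (0 < j < m - 1)%N ->
      (forall i : 'I_k, 0 < partial (idx i) f 0) \/
      (forall i : 'I_k, partial (idx i) f 0 < 0) ->
      exists b : branch f L, bifurcation_branch b /\ ~ lifted_from N b).
Proof.
have [V [Vo Vd VP]] := @generic_second_order R k.
exists V; split => // f fF Vf L n C' j LF LN Lb Lj /andP[j0 jm] fy.
have {}jm : (j <= m)%N by rewrite (leq_trans (ltnW jm)) ?leq_subr.
have [fxx fxt] := VP f fF Vf.
have [a [tau [e [delta [kappa [a0 tau1 e1 hF]]]]]] := exists_fold_form fF fxx fxt fy.
have [c [d [cd cj dj ecd]]] := lift_merges hN LF LN Lb Lj (introT andP (conj j0 jm)).
have [mn _ _] := Lj; subst n.
have [ly [_ lyC lys _ _]] := feed_forward_layer LF.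
have {}cj : ly c = j by apply/eqP; rewrite -lyC.
have {}dj : ly d = j by apply/eqP; rewrite -lyC.
(* The branch vanishes on [Z], which is closed under sources because those of [c] lie in layer
   [j - 1]. Outside [Z] layers are at least [j > 0], so sources strictly lower the layer, which
   serves as rank. The cell [d] is outside [Z]. *)
pose Z := [pred x | (ly x < j)%N || (x == c)].
have Z_src x i : Z x -> Z (src i x).
  rewrite /= lys => /orP[xj|/eqP ->]; first by rewrite (leq_ltn_trans (leq_pred _) xj).
  by rewrite cj prednK // leqnn.
have rank_src x i : ~~ Z x -> (ly (src i x) < ly x)%N.
  rewrite /= negb_or -leqNgt lys => /andP[jx _].
  by rewrite prednK // (leq_trans j0 jx).
have [b [bZ bn]] := branch_of_fold a0 tau1 e1 hF Z_src rank_src.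
have bs : separates c d b.
  exists kappa, 1; split => // [|l bl _]; first exact: fold_kappa_gt0 hF.
  rewrite (bZ c) ?subr0; last by rewrite /= eqxx orbT.
  by apply: bn => //=; rewrite dj ltnn /=; apply/eqP => dc; exact: cd.
exists b; split; first exact: separates_bifurcation bs.
exact: separates_not_lifted bs.
Qed.
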